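(* Let $n\ge1$ and $p\ge0$ be integers. In each item the sequence indexing the character on the left-hand side is assumed to be a partition, half-partition, $n$-orthogonal partition, or $n$-orthogonal half-partition, as appropriate for the character. All sums run over ordinary partitions $\nu$. (i) If $c$ is a nonnegative integer and $n\ge p$, then $$\operatorname{sp}_{2n}\big((c^{n-p},(c-1)^p);\mathbf x^{\pm1}\big)=(x_1x_2\cdots x_n)^{-c}\sum_{\nu\subseteq((2c)^n),\ \operatorname{oddrows}(\nu)=p}s_n(\nu;\mathbf x).$$ (ii) If $c$ is a nonnegative integer or half-integer and $2c\ge p$, then $$\operatorname{so}_{2n}\big((c^{n-1},c-p);\mathbf x^{\pm1}\big)=(x_1x_2\cdots x_n)^{-c}\sum_{\nu\subseteq((2c)^n),\ \operatorname{oddcols}(((2c)^n)/\nu)=p}s_n(\nu;\mathbf x).$$ (iii) If $c$ is a nonnegative integer or half-integer and $n\ge p$, then $$\operatorname{so}_{2n+1}\big((c^{n-p},(c-1)^p);\mathbf x^{\pm1}\big)=(x_1x_2\cdots x_n)^{-c}\sum_{\nu\subseteq((2c)^n)}a_{n,p}(\nu)\,s_n(\nu;\mathbf x),$$ where $a_{n,p}(\nu)$ is the number of vertical strips of length $p$ on the rim of $\nu$ avoiding the $(2c)$-th column. (iv) If $c$ is a nonnegative integer or half-integer and $c\ge p$, then $$\operatorname{so}_{2n+1}\big((c^{n-1},c-p);\mathbf x^{\pm1}\big)=(x_1x_2\cdots x_n)^{-c}\sum_{\nu\subseteq((2c)^n)}b_{n,p}(\nu)\,s_n(\nu;\mathbf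 x),$$ where $b_{n,p}(\nu)$ is the number of horizontal strips of length $p$ on the rim of $\nu$ such that, for $i=1,\dots,p$, the $i$-th cell of the strip (counted from left to right) lies in a column strictly before the $(2c-2p+2i)$-th column.
   Context: A partition is a weakly decreasing finite sequence of nonnegative integers, identified with its Ferrers diagram ($\lambda_i$ left-justified cells in row $i$); a half-integer is a number $k+1/2$ with $k$ an integer; a half-partition is a weakly decreasing sequence of nonnegative half-integers. An $n$-orthogonal partition (half-partition) is a sequence $\lambda_1\ge\lambda_2\ge\dots\ge\lambda_{n-1}\ge|\lambda_n|$ of integers (half-integers). $\mu\subseteq\lambda$ means $\mu_i\le\lambda_i$ for all $i$; then $\lambda/\mu$ is the set of cells of $\lambda$ not in $\mu$. A horizontal (vertical) strip is a skew diagram with at most one cell in each column (row); its length is its number of cells. A strip ''on the rim of $\nu$'' is a strip of the form $\nu/\mu$ with $\mu\subseteq\nu$ a partition; it ''avoids'' a column if it has no cell in that column. $\operatorname{oddrows}(\sigma)$, $\operatorname{oddcols}(\sigma)$ are the numbers of rows, columns of odd length of a (skew) diagram $\sigma$. $(c^{n})$ is the sequence of $n$ entries $c$; $(c^{n-1},c-p)$ has $n-1$ entries $c$ followed by $c-p$; $(c^{n-p},(c-1)^p)$ has $n-p$ entries $c$ followed by $p$ entries $c-1$. $s_n(\nu;\mathbf x)$ is the Schur polynomial $s_\nu(x_1,\dots,x_n)$. For a partition $\lambda=(\lambda_1,\dots,\lambda_n)$, $$\operatorname{sp}_{2n}(\lambda;\mathbf x^{\pm1})=\frac{\det_{1\le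 i,j\le n}\big(x_j^{\lambda_i+n-i+1}-x_j^{-(\lambda_i+n-i+1)}\big)}{\det_{1\le i,j\le n}\big(x_j^{n-i+1}-x_j^{-(n-i+1)}\big)}$$ is the irreducible symplectic character of $\mathrm{Sp}(2n,\mathbb C)$. For a partition or half-partition $\lambda=(\lambda_1,\dots,\lambda_n)$, $$\operatorname{so}_{2n+1}(\lambda;\mathbf x^{\pm1})=\frac{\det_{1\le i,j\le n}\big(x_j^{\lambda_i+n-i+1/2}-x_j^{-(\lambda_i+n-i+1/2)}\big)}{\det_{1\le i,j\le n}\big(x_j^{n-i+1/2}-x_j^{-(n-i+1/2)}\big)}.$$ For an $n$-orthogonal partition or half-partition $\lambda$, $$\operatorname{so}_{2n}(\lambda;\mathbf x^{\pm1})=\frac{\det_{1\le i,j\le n}\big(x_j^{\lambda_i+n-i}+x_j^{-(\lambda_i+n-i)}\big)+\det_{1\le i,j\le n}\big(x_j^{\lambda_i+n-i}-x_j^{-(\lambda_i+n-i)}\big)}{\det_{1\le i,j\le n}\big(x_j^{n-i}+x_j^{-(n-i)}\big)}.$$ These are the irreducible characters of $\mathrm{SO}(2n+1,\mathbb C)$, $\mathrm{SO}(2n,\mathbb C)$ and their spin covering groups. *)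

(* Defs.v *)
From mathcomp Require Export all_boot all_order all_algebra.
From mathcomp Require Export fraction.
From mathcomp.multinomials Require Export mpoly.

Set Implicit Arguments.
Unset Strict Implicit.
Unset Printing Implicit Defensive.

Export GRing.Theory Num.Theory.

Local Open Scope ring_scope.

(* A sequence (lambda_1, ..., lambda_n) of integers or half-integers is a function
   ['I_n -> rat]; since ['I_n] starts at 0, [lam i] is lambda_{i+1}. *)

Definition is_half_int (q : rat) : bool := q - 2^-1 \is a Num.int.

Definition weakly_decreasing (n : nat) (lam : 'I_n -> rat) : Prop :=
  forall i j : 'I_n, (i <= j)%N -> lam j <= lam i.

Definition is_partition (n : nat) (lam : 'I_n -> rat) : Prop :=
  weakly_decreasing lam /\ (forall i, 0 <= lam i /\ lam i \is a Num.int).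

Definition is_half_partition (n : nat) (lam : 'I_n -> rat) : Prop :=
  weakly_decreasing lam /\ (forall i, 0 <= lam i /\ is_half_int (lam i)).

(* lambda_1 >= ... >= lambda_{n-1} >= |lambda_n|; no condition when n = 1. *)
Definition orthogonal_decreasing (n : nat) (lam : 'I_n -> rat) : Prop :=
  forall i j : 'I_n, i.+1 = j ->
    (if j.+1 == n then `|lam j| else lam j) <= lam i.

Definition is_orthogonal_partition (n : nat) (lam : 'I_n -> rat) : Prop :=
  orthogonal_decreasing lam /\ (forall i, lam i \is a Num.int).

Definition is_orthogonal_half_partition (n : nat) (lam : 'I_n -> rat) : Prop :=
  orthogonal_decreasing lam /\ (forall i, is_half_int (lam i)).

(* (a^(n-k), b^k), for k <= n. *)
Definition two_block (n k : nat) (a b : rat) : 'I_n -> rat :=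
  fun i => if (i < n - k)%N then a else b.

(* The fraction field of K[x_1^(1/2), ..., x_n^(1/2)], in which the characters
   are taken: the indeterminate ['X_j] stands for x_j^(1/2).  All the
   denominators below are nonzero in this field when K has characteristic 0. *)
Definition ratfun (K : fieldType) (n : nat) : fieldType :=
  {fraction {mpoly K[n]}}.

(* x_j ^ q; meaningful for q an integer or a half-integer, where 2q is an
   integer and the floor is exact. *)
Definition xpow (K : fieldType) (n : nat) (j : 'I_n) (q : rat) : ratfun K n :=
  tofrac ('X_j : {mpoly K[n]}) ^ Num.floor (2 * q).

(* n - i in 1-based indexing. *)
Definition delta (n : nat) (i : 'I_n) : rat := (n - i.+1)%:R.

Definition det_xpow (K : fieldType) (n : nat) (e : 'I_n -> rat) : ratfun K n :=
  \det (\matrix_(i < n, j < n) xpow K j (e i)).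

Definition det_xpow_sub (K : fieldType) (n : nat) (e : 'I_n -> rat)
    : ratfun K n :=
  \det (\matrix_(i < n, j < n) (xpow K j (e i) - xpow K j (- e i))).

Definition det_xpow_add (K : fieldType) (n : nat) (e : 'I_n -> rat)
    : ratfun K n :=
  \det (\matrix_(i < n, j < n) (xpow K j (e i) + xpow K j (- e i))).

(* The Schur polynomial in x_1, ..., x_n as a quotient of alternants. *)
Definition schur (K : fieldType) (n : nat) (lam : 'I_n -> rat) : ratfun K n :=
  det_xpow K (fun i => lam i + delta i) / det_xpow K (@delta n).

Definition sp_even (K : fieldType) (n : nat) (lam : 'I_n -> rat) : ratfun K n :=
  det_xpow_sub K (fun i => lam i + delta i + 1) /
  det_xpow_sub K (fun i : 'I_n => delta i + 1).

Definition so_odd (K : fieldType) (n : nat) (lam : 'I_n -> rat) : ratfun K n :=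
  det_xpow_sub K (fun i => lam i + delta i + 2^-1) /
  det_xpow_sub K (fun i : 'I_n => delta i + 2^-1).

Definition so_even (K : fieldType) (n : nat) (lam : 'I_n -> rat) : ratfun K n :=
  (det_xpow_add K (fun i => lam i + delta i) +
   det_xpow_sub K (fun i => lam i + delta i)) /
  det_xpow_add K (@delta n).

Definition xprod_pow (K : fieldType) (n : nat) (q : rat) : ratfun K n :=
  \prod_(j < n) xpow K j q.

(* With [box_part] below, the partitions contained in (m^n), padded with zeros to
   length n. *)
Definition box (n m : nat) : finType := {ffun 'I_n -> 'I_m.+1}.

Definition box_part (n m : nat) (nu : box n m) : bool :=
  [forall i : 'I_n, forall j : 'I_n, (i <= j)%N ==> (nu j <= nu i)%N].

Definition box_sub (n m : nat) (mu nu : box n m) : bool :=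
  [forall i : 'I_n, (mu i <= nu i)%N].

Definition box_full (n m : nat) : box n m := [ffun=> ord_max].

Definition weight_of (n m : nat) (nu : box n m) : 'I_n -> rat :=
  fun i => (nu i : nat)%:R.

(* The pair (i, j) is the cell in row i+1 and column j+1. *)
Definition diagram (n m : nat) (nu : box n m) : {set 'I_n * 'I_m} :=
  [set u : 'I_n * 'I_m | (u.2 < nu u.1)%N].

Definition skew (n m : nat) (nu mu : box n m) : {set 'I_n * 'I_m} :=
  diagram nu :\: diagram mu.

Definition row_len (n m : nat) (D : {set 'I_n * 'I_m}) (i : 'I_n) : nat :=
  #|[set u in D | u.1 == i]|.

Definition col_len (n m : nat) (D : {set 'I_n * 'I_m}) (j : 'I_m) : nat :=
  #|[set u in D | u.2 == j]|.

Definition oddrows (n m : nat) (D : {set 'I_n * 'I_m}) : nat :=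
  #|[set i : 'I_n | odd (row_len D i)]|.

Definition oddcols (n m : nat) (D : {set 'I_n * 'I_m}) : nat :=
  #|[set j : 'I_m | odd (col_len D j)]|.

Definition hstrip (n m : nat) (D : {set 'I_n * 'I_m}) : bool :=
  [forall j : 'I_m, (col_len D j <= 1)%N].

Definition vstrip (n m : nat) (D : {set 'I_n * 'I_m}) : bool :=
  [forall i : 'I_n, (row_len D i <= 1)%N].

Definition avoids_col (n m : nat) (D : {set 'I_n * 'I_m}) (k : nat) : bool :=
  [forall u in D, u.2.+1 != k].

(* The column numbers (starting at 1) of the cells of D, from left to right. *)
Definition cell_cols (n m : nat) (D : {set 'I_n * 'I_m}) : seq nat :=
  sort leq [seq (nat_of_ord u.2).+1 | u <- enum D].

(* A strip on the rim of nu is determined by the partition mu that remains when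
   it is removed, so strips are counted through mu. *)
Definition rim_vstrips (n m p : nat) (nu : box n m) : nat :=
  #|[set mu : box n m |
      [&& box_part mu, box_sub mu nu, vstrip (skew nu mu),
          #|skew nu mu| == p & avoids_col (skew nu mu) m]]|.

(* [i < p] is the (i+1)-st cell.  The subtraction is never truncated where this
   is used, namely for 2p <= m. *)
Definition rim_hstrips (n m p : nat) (nu : box n m) : nat :=
  #|[set mu : box n m |
      [&& box_part mu, box_sub mu nu, hstrip (skew nu mu),
          #|skew nu mu| == p &
          [forall i : 'I_p,
             (nth 0%N (cell_cols (skew nu mu)) i < m - 2 * p + 2 * i.+1)%N]]]|.

(* Main.v *)
Require Import Defs.
From mathcomp Require Import perm ring zify.
From Stdlib Require Import FunctionalExtensionality.

(** Why the identities hold.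

    Write theta(z) = z + 1/z.  For a sign choice, recorded by the set U of the
    indices i with y_i = x_i (and y_i = 1/x_i otherwise), the Vandermonde
    product of the y_i is that of the theta(x_i) times
    K(U) = prod_(i < j) 1 / (1 - 1 / (y_i y_j)).  Expanding the columns of
    det (a(x_j) x_j^k + b(x_j) x_j^(-k)) therefore gives the Vandermonde
    product of the theta(x_i) times the sum, over all U, of
    K(U) prod_(i in U) a(x_i) prod_(i not in U) b(x_i); this is
    [sign_sum_det].  The Weyl denominators are the same Vandermonde product
    times factors in one variable, so the characters become sums over sign
    choices in which 2c occurs only as an exponent in a.

    The other side is a sum over chains m >= u_1 >= ... >= u_n >= 0 of Schur
    polynomials.  Laplace expansion of the alternant along the row of the
    largest part removes one variable ([schurx_cons], with the operator [peel]),
    so the sum for m minus the sum for m - 1 is [peel] applied to the sum in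
    n - 1 variables.  [peel] also turns a sum over sign choices into a sum over
    sign choices: the factor that it creates in the term of U is a sum over j in
    U which partial fractions evaluate ([residue_sum]).  Hence both sides obey
    one recursion in n and m.  They also agree one step before m = 0: there the
    range of summation is empty, and the determinant has a zero row or two
    proportional rows.  At m = 0 the sum is 1, which gives the denominator
    formulas of Weyl.

    The integer p is handled by a generating function in a parameter t; the
    identities are proved for all but finitely many t, which suffices for the
    comparison of coefficients.

    Shapes with a shortened column.  If the rows of a determinant are
    R_(k+1) + t R_k, its coefficient of t^p is the determinant with R_p omitted
    from R_0, ..., R_n ([det_omit_row]); for R_k = x^(a+k) - x^(-(a+k)), where
    a = c in the symplectic and a = c - 1/2 in the odd orthogonal case, these are
    the numerators of the characters.  In the symplectic case t marks the odd
    parts of the chain ([chainsum_C]).  In the odd orthogonal case a vertical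
    strip nu/mu is encoded by the chain u = nu + mu, whose odd entries mark the
    removed cells, and the forbidden last column is the forbidden value 2m - 1
    ([chainsum_vstrips], deduced from the Pieri rule [chainsum_pieri]).

    Shapes with a shortened row.  Here t is adjoined to the variables.  Row
    operations reduce the determinant for the rectangle in n + 1 variables to
    determinants in n variables whose last row is a Christoffel-Darboux sum
    ([det_adjoin], [darboux]), and its terms are the numerators of the
    characters.  On the other side, the number of odd columns of the complement
    is an alternating sum of parts, a weight that [chainsum_D] sums.  For the
    horizontal strips one uses the weight
    [m - nu_1 + 1] [nu_1 - nu_2 + 1] ... [nu_n + 1], a product of q-integers in
    t; by the Clebsch-Gordan rule it is the sum of t^p [m - 2p + 1] over the
    admissible strips, p being the length ([strip_weight_sum]), as the condition
    on the columns is the ballot condition for highest weight vectors. *)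

Set Implicit Arguments.
Unset Strict Implicit.
Unset Printing Implicit Defensive.

Local Open Scope ring_scope.

(** * Products with one index removed *)

Lemma ltn_bump2 j i k : (bump j i < bump j k)%N = (i < k)%N.
Proof. by rewrite /bump; lia. Qed.

Section LiftProducts.
Variable R : comNzRingType.

Lemma prod_lift n (j : 'I_n.+1) (f : 'I_n.+1 -> R) :
  \prod_(i | i != j) f i = \prod_(i < n) f (lift j i).
Proof.
rewrite big_mkcond (bigD1_ord j) //= eqxx mul1r.
by apply: eq_bigr => i _; rewrite eq_sym neq_lift.
Qed.

Lemma pairprod_lift n (j : 'I_n.+1) (f : 'I_n.+1 -> 'I_n.+1 -> R) :
  (forall i k, f i k = f k i) ->
  \prod_(i < n.+1) \prod_(k < n.+1 | (i < k)%N) f i k =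
  (\prod_(i < n) \prod_(k < n | (i < k)%N) f (lift j i) (lift j k)) *
  \prod_(i < n) f j (lift j i).
Proof.
move=> fC; rewrite (bigD1_ord j) //= mulrC.
under eq_bigr => i _.
  rewrite big_mkcond (bigD1_ord j) //= -big_mkcond /=.
  under eq_bigl => k do rewrite ltn_bump2.
  over.
rewrite big_split /= mulrC mulrA [LHS]mulrC; congr (_ * _).
rewrite big_mkcond (bigD1_ord j) //= ltnn mul1r -big_split /=.
apply: eq_bigr => i _; rewrite (fC (lift j i)).
have := neq_bump j i; rewrite -/(lift j i) /=.
by case: ltngtP => //=; rewrite ?mulr1 ?mul1r.
Qed.

End LiftProducts.

(** * Determinants as sums over sign choices *)

Section SignSums.
Variable F : fieldType.
Implicit Types (a b g : F -> F).

(** The invariant of z under z -> 1/z, so that products of differences of its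
    values do not see the sign choices. *)
Definition theta (z : F) := z + z^-1.

Definition flip n (x : 'I_n -> F) (U : {set 'I_n}) (i : 'I_n) : F :=
  if i \in U then x i else (x i)^-1.

Definition vandermonde n (x : 'I_n -> F) : F :=
  \prod_(i < n) \prod_(j < n | (i < j)%N) (x i - x j).

(** The factor by which the Vandermonde product of the signed variables
    exceeds that of their [theta]; see [vandermonde_flip]. *)
Definition sign_weight n (x : 'I_n -> F) (U : {set 'I_n}) : F :=
  \prod_(i < n) \prod_(j < n | (i < j)%N) (1 - (flip x U i * flip x U j)^-1)^-1.

Definition sign_sum n (x : 'I_n -> F) a b : F :=
  \sum_(U : {set 'I_n})
    sign_weight x U * \prod_i (if i \in U then a (x i) else b (x i)).

(** Exactly what makes the values of [theta] distinct and all the factors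
    1 - 1/(y_i y_j) nonzero; i = j is allowed in the last clause, so no variable
    is 1 or -1. *)
Definition generic n (x : 'I_n -> F) : Prop :=
  [/\ forall i, x i != 0, forall i j, i != j -> x i != x j
    & forall i j, x i * x j != 1].

Lemma generic_lift n (x : 'I_n.+1 -> F) (j : 'I_n.+1) :
  generic x -> generic (x \o lift j).
Proof.
by case=> h1 h2 h3; split=> [i|i k ik|i k] //=; apply: h2; rewrite (inj_eq lift_inj).
Qed.

Lemma det_vandermonde n (x : 'I_n -> F) :
  \det (\matrix_(i < n, j < n) x j ^+ (n - i.+1)) = vandermonde x.
Proof.
pose V := Vandermonde n (\row_j x (rev_ord j)).
pose s : 'S_n := perm (@rev_ord_inj n).
have -> : \matrix_(i < n, j < n) x j ^+ (n - i.+1) = row_perm s (col_perm s V).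
  by apply/matrixP=> i j; rewrite !mxE !permE /= rev_ordK.
rewrite row_permE col_permE !det_mulmx !det_perm odd_permV mulrCA -signr_addb.
rewrite addbb mulr1 det_Vandermonde /vandermonde.
rewrite (reindex_inj rev_ord_inj) /=.
under eq_bigr do rewrite (reindex_inj rev_ord_inj) /=.
under eq_bigr => i _ do under eq_bigr do rewrite !mxE !rev_ordK.
rewrite (exchange_big_dep predT) //=.
apply: eq_bigr => i _; apply: eq_bigl => j; have := ltn_ord j; have := ltn_ord i; lia.
Qed.

(** theta(y) - theta(z) = (y - z) (1 - 1/(y z)), and theta does not
    change when a variable is inverted. *)
Lemma vandermonde_flip n (x : 'I_n -> F) (U : {set 'I_n}) : generic x ->
  vandermonde (flip x U) = vandermonde (theta \o x) * sign_weight x U.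
Proof.
case=> h1 h2 h3; rewrite /vandermonde /sign_weight -big_split; apply: eq_bigr => i _.
rewrite -big_split; apply: eq_bigr => j ij /=.
have ij' : i != j by apply/eqP => e; rewrite e ltnn in ij.
have := h1 i; have := h1 j; have := h3 i j; have := h2 _ _ ij'; move=> hd hij hj hi.
have hd1 : x j - x i != 0 by rewrite subr_eq0 eq_sym.
have hd2 : x i - x j != 0 by rewrite subr_eq0.
have hp : x i * x j - 1 != 0 by rewrite subr_eq0.
have hq : 1 - x i * x j != 0 by rewrite subr_eq0 eq_sym.
rewrite /theta /flip; case: (i \in U); case: (j \in U); field;
  by rewrite ?hi ?hj ?hd1 ?hd2 ?hp ?hq ?oner_eq0.
Qed.

(** Each column is a sum of two columns; choosing one of them in every column
    leaves an alternant in the signed variables. *)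
Lemma sign_sum_det n (x : 'I_n -> F) a b : generic x ->
  vandermonde (theta \o x) * sign_sum x a b =
  \det (\matrix_(i < n, j < n)
          (a (x j) * x j ^+ (n - i.+1) + b (x j) * x j ^- (n - i.+1))).
Proof.
move=> gx; rewrite -det_tr /determinant.
under [RHS]eq_bigr => s _.
  under eq_bigr do rewrite !mxE.
  rewrite bigA_distr mulr_sumr; over.
rewrite exchange_big /sign_sum mulr_sumr; apply: eq_bigr => U _ /=.
rewrite mulrA -vandermonde_flip // -det_vandermonde -det_tr /determinant mulr_suml.
apply: eq_bigr => s _; rewrite -mulrA; congr (_ * _).
rewrite -big_split; apply: eq_bigr => i _; rewrite !mxE /flip /=.
by case: ifP => _; rewrite ?exprVn mulrC.
Qed.

(** Laplace expansion along the first row of an alternant, divided by the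
    Vandermonde product: for g = z^v it prepends the part v to the shape of a
    Schur polynomial ([schurx_cons]). *)
Definition peel n g (x : 'I_n.+1 -> F) (f : ('I_n -> F) -> F) : F :=
  \sum_j g (x j) * (\prod_i (1 - x (lift j i) / x j)^-1) * f (x \o lift j).

(** The quotient of the two possible factors of a pair j, i with j in U:
    the one in [sign_weight], when i is in U too, by the one in [peel]. *)
Definition cross n (x : 'I_n -> F) (j i : 'I_n) : F :=
  (x j - (x i)^-1) / (x j - x i).

Lemma sum_sets_lift n (j : 'I_n.+1) (f : {set 'I_n} -> F) :
  \sum_(U : {set 'I_n}) f U =
  \sum_(U : {set 'I_n.+1} | j \in U) f (lift j @^-1: U).
Proof.
rewrite (reindex_onto (fun U : {set 'I_n.+1} => lift j @^-1: U)
                      (fun U => j |: lift j @: U)) /=; last first.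
  move=> U _; apply/setP=> i; rewrite !inE (eq_sym _ j) (negbTE (neq_lift _ _)) /=.
  by rewrite (mem_imset _ _ lift_inj).
apply: eq_bigl => U; apply/eqP/idP => [<-|jU]; first by rewrite setU11.
apply/setP=> i; rewrite !inE; case: (unliftP j i) => [k|] ->; last by rewrite eqxx jU.
by rewrite (eq_sym _ j) (negbTE (neq_lift _ _)) /= (mem_imset _ _ lift_inj) inE.
Qed.

Lemma sign_weight_lift n (x : 'I_n.+1 -> F) (j : 'I_n.+1) (U : {set 'I_n.+1}) :
  j \in U ->
  sign_weight x U = sign_weight (x \o lift j) (lift j @^-1: U) *
    \prod_i (1 - (x j * flip x U (lift j i))^-1)^-1.
Proof.
move=> jU; rewrite /sign_weight (pairprod_lift j); last by move=> i k; rewrite mulrC.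
congr (_ * _); last first.
  by apply: eq_bigr => i _; rewrite [flip x U j]/flip jU.
apply: eq_bigr => i _; apply: eq_bigr => k _.
by rewrite /flip /= !inE.
Qed.

(** The pairs (j, U') with U' a set of the other indices are regrouped by
    U = U' + j.  For i outside U the factor of [peel] cancels against the one of
    [sign_weight], and only the pairs inside U leave a trace. *)
Lemma peel_sign_sum n g (x : 'I_n.+1 -> F) a b : generic x ->
  peel g x (fun y => sign_sum y a b) =
  \sum_U sign_weight x U * (\prod_(i | i \notin U) b (x i)) *
    \sum_(j in U) g (x j) * \prod_(i in U | i != j) (cross x j i * a (x i)).
Proof.
move=> gx; case: (gx) => h1 h2 h3; rewrite /peel /sign_sum.
under eq_bigr => j _.
  rewrite mulr_sumr (sum_sets_lift j); over.
rewrite (exchange_big_dep predT) //=; apply: eq_bigr => U _.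
rewrite mulr_sumr; apply: eq_bigr => j jU.
rewrite (sign_weight_lift _ jU).
have -> : \prod_(i | i \notin U) b (x i) =
          \prod_(i < n) (if lift j i \in U then 1 else b (x (lift j i))).
  rewrite -(prod_lift j (fun i => if i \in U then 1 else b (x i))).
  rewrite [LHS]big_mkcond [RHS]big_mkcond; apply: eq_bigr => i _.
  by case: eqP => [->|_]; [rewrite jU | case: (i \in U)].
have -> : \prod_(i in U | i != j) (cross x j i * a (x i)) =
   \prod_(i < n) (if lift j i \in U
                   then cross x j (lift j i) * a (x (lift j i)) else 1).
  rewrite -(prod_lift j (fun i => if i \in U then cross x j i * a (x i) else 1)).
  rewrite [LHS]big_mkcond [RHS]big_mkcond; apply: eq_bigr => i _.
  by case: eqP => _; rewrite ?andbF ?andbT //; case: (_ \in U).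
set s := sign_weight _ _; set A := \prod_i _; set B := \prod_i _.
set C := \prod_i _; set D := \prod_i _; set E := \prod_i _.
suff H : B * C = A * D * E by transitivity (g (x j) * s * (B * C)); [ring | rewrite H; ring].
rewrite /A /B /C /D /E -!big_split; apply: eq_bigr => i _ /=.
rewrite inE /flip /cross; have := h1 j; have := h1 (lift j i).
have := h2 _ _ (neq_lift j i); have := h3 j (lift j i).
set u := x (lift j i); set v := x j => uv ne u0 v0.
have e1 : v - u != 0 by rewrite subr_eq0.
have e2 : v * u - 1 != 0 by rewrite subr_eq0.
case: ifP => _; first by field; rewrite e2 v0 u0 e1.
by rewrite mulr1 invf_div.
Qed.

End SignSums.
Arguments theta {F} z.

(** * A partial fraction identity *)

Section Residues.
Variables (F : fieldType) (n : nat) (x : 'I_n -> F).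
Hypothesis gx : generic x.
Implicit Types (U : {set 'I_n}) (a b t : F).

(** The residues of the product of (z - 1/x_i) / (z - x_i) over i in U,
    divided by z - a, add up to its value 1 at infinity. *)
Lemma residue_sum U a : (forall i, i \in U -> x i != a) ->
  \sum_(j in U) (x j - (x j)^-1) / (x j - a) *
     \prod_(i in U | i != j) cross x j i =
  1 - \prod_(i in U) ((a - (x i)^-1) / (a - x i)).
Proof.
case: gx => h1 h2 h3 ha.
(* Interpolation of P - W, which has degree less than #|U|, at the x_i;
   the claim is its value at a divided by the value of W. *)
pose W := \prod_(i in U) ('X - (x i)%:P).
pose P := \prod_(i in U) ('X - ((x i)^-1)%:P).
pose c j := P.[x j] / \prod_(i in U | i != j) (x j - x i).
pose L := \sum_(j in U) c j *: \prod_(i in U | i != j) ('X - (x i)%:P).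
have hprod (Q : pred 'I_n) (y : 'I_n -> F) z :
    (\prod_(i | Q i) ('X - (y i)%:P)).[z] = \prod_(i | Q i) (z - y i).
  by rewrite horner_prod; apply: eq_bigr => i _; rewrite !hornerE.
have hc j : \prod_(i in U | i != j) (x j - x i) != 0.
  by apply/prodf_neq0 => i /andP[_ ij]; rewrite subr_eq0; apply: h2; rewrite eq_sym.
have szp (A : {set 'I_n}) (y : 'I_n -> F) :
    size (\prod_(i in A) ('X - (y i)%:P)) = #|A|.+1.
  by rewrite -big_enum size_prod_XsubC -cardE.
have mon (y : 'I_n -> F) : (\prod_(i in U) ('X - (y i)%:P))`_#|U| = 1.
  have /monicP : \prod_(i in U) ('X - (y i)%:P) \is monic by apply: monic_prod_XsubC.
  by rewrite lead_coefE szp.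
have szPW : (size (P - W)%R <= #|U|)%N.
  apply/leq_sizeP => k; rewrite leq_eqVlt => /orP[/eqP <-|hk].
    by rewrite coefB !mon subrr.
  by rewrite nth_default // (leq_trans (size_polyD _ _)) // size_polyN !szp maxnn.
have szL : (size L <= #|U|)%N.
  apply: (leq_trans (size_sum _ _ _)); apply/bigmax_leqP => j jU.
  apply: (leq_trans (size_scale_leq _ _)).
  have -> : \prod_(i in U | i != j) ('X - (x i)%:P) =
      \prod_(i in U :\ j) ('X - (x i)%:P).
    by apply: eq_bigl => i; rewrite in_setD1 andbC.
  by rewrite szp (cardsD1 j U) jU.
have key : P - W - L = 0.
  apply: (@roots_geq_poly_eq0 _ _ [seq x i | i <- enum U]).
  - apply/allP => z /mapP[k]; rewrite mem_enum => kU ->.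
    rewrite rootE !hornerE /L horner_sum (bigD1 k) //= [X in _ - (_ + X)]big1 => [|j /andP[jU jk]].
      rewrite hornerZ !hprod addr0 /c hprod divfK // (bigD1 k kU) /= [\prod_(i in U) (x k - x i)](bigD1 k kU) /=.
      by rewrite subrr mul0r subr0 subrr.
    by rewrite hornerZ hprod (bigD1 k) /= ?kU 1?eq_sym // subrr mul0r mulr0.
  - rewrite map_inj_uniq ?enum_uniq // => i k; apply: contra_eq; exact: h2.
  - by rewrite size_map -cardE (leq_trans (size_polyD _ _)) // size_polyN geq_max szPW.
have {key} := congr1 (fun p => p.[a]) key.
have W0 : \prod_(i in U) (a - x i) != 0.
  by apply/prodf_neq0 => i iU; rewrite subr_eq0 eq_sym ha.
rewrite !hornerE !hprod /L horner_sum prodf_div => /eqP.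
rewrite subr_eq add0r subr_eq => /eqP ->; rewrite mulrDl divff // opprD.
rewrite addrCA subrr addr0 mulr_suml -sumrN; apply: eq_bigr => j jU.
rewrite hornerZ hprod /c hprod [X in X / \prod_(_ in _) _]mulrC.
rewrite (bigD1 j jU) /= [\prod_(i in U) (a - x i)](bigD1 j jU) /= /cross prodf_div.
have h4 : a - x j != 0 by rewrite subr_eq0 eq_sym ha.
have h5 : x j - a != 0 by rewrite subr_eq0 ha.
set A := \prod_(_ in _ | _) (x j - _^-1).
have := hc j; set B := \prod_(_ in _ | _) (x j - _) => hB.
have := W0; rewrite (bigD1 j jU) /= mulf_eq0 negb_or => /andP[_].
set C := \prod_(_ in _ | _) _ => hC.
by field; rewrite hB h5 hC h4 h1.
Qed.

End Residues.

(** * Schur polynomials: expansion along the largest part *)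

Section SchurPeel.
Variable F : fieldType.

(** The Schur polynomial of the shape s, padded by zeros, at a point; the
    extension of the definition to all sequences is used with
    [schurx_repeat]. *)
Definition schurx n (x : 'I_n -> F) (s : seq nat) : F :=
  \det (\matrix_(i < n, j < n) x j ^+ (nth 0%N s i + (n - i.+1))) / vandermonde x.

Lemma vandermonde_lift n (x : 'I_n.+1 -> F) (j : 'I_n.+1) :
  vandermonde x = (-1) ^+ j * vandermonde (x \o lift j) * \prod_i (x j - x (lift j i)).
Proof.
(* a symmetric function that agrees with the difference on the pairs i < k *)
pose f (i k : 'I_n.+1) := if (i < k)%N then x i - x k else x k - x i.
have fC i k : f i k = f k i.
  by rewrite /f; case: ltngtP => // /val_inj ->.
have -> : vandermonde x = \prod_(i < n.+1) \prod_(k < n.+1 | (i < k)%N) f i k.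
  by apply: eq_bigr => i _; apply: eq_bigr => k ik; rewrite /f ik.
rewrite (pairprod_lift j fC) -mulrA mulrCA; congr (_ * _).
  apply: eq_bigr => i _; apply: eq_bigr => k ik.
  by rewrite /f /= ltn_bump2 ik.
have jn : (j <= n)%N by rewrite -ltnS.
have -> : (-1) ^+ j = \prod_(i < n) (if (i < j)%N then -1 else 1) :> F.
  rewrite -big_mkcond -(big_ord_widen n (fun=> -1)) //.
  by rewrite prodr_const card_ord.
rewrite -big_split; apply: eq_bigr => i _ /=; rewrite /f /=.
rewrite (_ : (j < bump j i)%N = ~~ (i < j)%N); last by rewrite /bump; lia.
by case: (i < j)%N => /=; rewrite ?mulN1r ?opprB ?mul1r.
Qed.

Lemma vandermonde_neq0 n (x : 'I_n -> F) :
  (forall i j, i != j -> x i != x j) -> vandermonde x != 0.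
Proof.
move=> h; apply/prodf_neq0 => i _; apply/prodf_neq0 => j ij.
by rewrite subr_eq0 h //; apply/eqP => e; rewrite e ltnn in ij.
Qed.

Lemma schurx_cons n (x : 'I_n.+1 -> F) v s : generic x ->
  schurx x (v :: s) = peel (fun z => z ^+ v) x (fun y => schurx y s).
Proof.
move=> gx; have [h1 h2 _] := gx.
rewrite /schurx (expand_det_row _ ord0) mulr_suml; apply: eq_bigr => j _.
rewrite mxE /cofactor add0n (vandermonde_lift x j) /= subSS subn0.
set A := \det _; set B := \det _.
have -> : A = B.
  by congr (\det _); apply/matrixP=> i k; rewrite !mxE /= /bump /= add1n subSS.
have := vandermonde_neq0 h2; rewrite (vandermonde_lift x j) !mulf_eq0 !negb_or.
case/andP => /andP[hs hv]; set C := \prod_i _ => hC.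
have -> : \prod_i (1 - x (lift j i) / x j)^-1 = x j ^+ n / C.
  rewrite -[n in X in X / C]card_ord -prodr_const -prodf_div.
  apply: eq_bigr => i _; have := h2 _ _ (neq_lift j i); have := h1 j => xj0 xjl.
  by field; rewrite xj0 subr_eq0 xjl.
rewrite exprD; field; by rewrite hC hv hs.
Qed.

(** A case of the straightening rule: after the shift by the row index the
    exponents of v and v + 1 coincide. *)
Lemma schurx_repeat n (x : 'I_n.+2 -> F) v s :
  schurx x (v :: v.+1 :: s) = 0.
Proof.
rewrite /schurx (@determinant_alternate _ _ _ ord0 (lift ord0 ord0)) ?mul0r //.
by move=> j; rewrite !mxE /=; congr (_ ^+ _); rewrite /bump /=; lia.
Qed.

End SchurPeel.

(** * Sums over partitions in a box *)

Lemma geq_trans : transitive geq.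
Proof. by move=> p q z /= u v; apply: leq_trans v u. Qed.

Section ChainSums.
Variable R : comNzRingType.
Implicit Types (n m M v : nat) (f : seq nat -> R).

(** Sum over the weakly decreasing sequences of length n with entries at
    most M, largest entry first, so that it can be peeled together with the
    Schur polynomials. *)
Fixpoint chainsum n M f : R :=
  if n is n'.+1 then \sum_(v < M.+1) chainsum n' v (fun s => f (val v :: s))
  else f [::].

Lemma chainsumS n M f :
  chainsum n.+1 M.+1 f =
  chainsum n.+1 M f + chainsum n M.+1 (fun s => f (M.+1 :: s)).
Proof. by rewrite /= big_ord_recr. Qed.

Lemma chainsum0 n f : chainsum n.+1 0 f = chainsum n 0 (fun s => f (0%N :: s)).
Proof. by rewrite /= big_ord1. Qed.

Lemma eq_chainsum n M f f' :
  (forall s, size s = n -> path geq M s -> f s = f' s) ->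
  chainsum n M f = chainsum n M f'.
Proof.
elim: n M f f' => [|n IHn] M f f' H /=; first exact: H.
apply: eq_bigr => v _; apply: IHn => s sn vs; apply: H => /=; first by rewrite sn.
by rewrite vs andbT -ltnS.
Qed.

Lemma chainsum_sum (I : finType) n M (f : I -> seq nat -> R) :
  chainsum n M (fun s => \sum_i f i s) = \sum_i chainsum n M (f i).
Proof.
elim: n M f => [|n IHn] M f //=.
by rewrite exchange_big /=; apply: eq_bigr => v _; rewrite IHn.
Qed.

Lemma chainsumZ n M c f :
  chainsum n M (fun s => c * f s) = c * chainsum n M f.
Proof.
elim: n M f => [|n IHn] M f //=.
by rewrite mulr_sumr; apply: eq_bigr => v _; rewrite IHn.
Qed.

Definition boxseq n m (nu : box n m) : seq nat :=
  [seq val (nu i) | i <- enum 'I_n].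

Lemma size_boxseq n m (nu : box n m) : size (boxseq nu) = n.
Proof. by rewrite size_map size_enum_ord. Qed.

Lemma nth_boxseq n m (nu : box n m) (i : 'I_n) : nth 0%N (boxseq nu) i = nu i.
Proof. by rewrite (nth_map i) ?size_enum_ord // nth_ord_enum. Qed.

(** The same sum without the monotonicity condition, for pairs of sequences
    on which the condition is imposed by the summand. *)
Fixpoint boxsum n m f : R :=
  if n is n'.+1 then \sum_(v < m.+1) boxsum n' m (fun s => f (val v :: s))
  else f [::].

Lemma boxsumE n m f : \sum_(nu : box n m) f (boxseq nu) = boxsum n m f.
Proof.
elim: n f => [|n IHn] f /=.
  rewrite (eq_bigr (fun=> f [::])) => [|nu _]; last first.
    by rewrite /boxseq (size0nil (size_enum_ord 0)).
  by rewrite sumr_const card_ffun !card_ord expn0 mulr1n.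
under [RHS]eq_bigr do rewrite -IHn.
rewrite pair_big /=.
pose h (p : 'I_m.+1 * box n m) : box n.+1 m :=
  [ffun i => oapp p.2 p.1 (unlift ord0 i)].
rewrite (reindex h) /=; last first.
  exists (fun nu : box n.+1 m => (nu ord0, [ffun i => nu (lift ord0 i)])).
    case=> v nu _ /=; rewrite !ffunE unlift_none; congr (_, _).
    by apply/ffunP=> i; rewrite !ffunE liftK.
  move=> nu _; apply/ffunP=> i; rewrite !ffunE.
  by case: (unliftP ord0 i) => [j|] -> /=; rewrite ?ffunE.
apply: eq_bigr => -[v nu] _ /=; congr f.
rewrite /boxseq enum_ordSl /= ffunE unlift_none; congr (_ :: _).
by rewrite -map_comp; apply: eq_map => i /=; rewrite ffunE liftK.
Qed.

Lemma boxsum0 n m : boxsum n m (fun=> 0) = 0.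
Proof. by rewrite -boxsumE big1. Qed.

Lemma boxsum_path n m M f : (M <= m)%N ->
  boxsum n m (fun s => if path geq M s then f s else 0) = chainsum n M f.
Proof.
elim: n M f => [|n IHn] M f Mm //=.
rewrite [RHS](big_ord_widen m.+1 (fun v => chainsum n v (fun s => f (v :: s)))) //.
rewrite [RHS]big_mkcond; apply: eq_bigr => v _ /=; rewrite ltnS.
case: (leqP v M) => [vM|_].
  by rewrite -IHn ?(leq_trans vM).
by rewrite boxsum0.
Qed.

Lemma box_partE n m (nu : box n m) : box_part nu = path geq m (boxseq nu).
Proof.
have geq_refl : reflexive geq by move=> a /=.
rewrite (path_sortedE geq_trans) (_ : all _ _ = true) /=; last first.
  by apply/allP => _ /mapP[i _ ->] /=; rewrite -ltnS.
apply/forallP/idP => [H|H i].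
  apply/(sortedP 0%N) => i; rewrite size_boxseq => hi.
  have /forallP/(_ (Ordinal hi))/implyP := H (Ordinal (ltnW hi)).
  by rewrite -!nth_boxseq; apply.
apply/forallP => j; apply/implyP => ij; rewrite -!nth_boxseq.
by apply: (sorted_leq_nth geq_trans geq_refl); rewrite ?inE ?size_boxseq.
Qed.

Lemma sum_box_part n m f :
  \sum_(nu : box n m | box_part nu) f (boxseq nu) = chainsum n m f.
Proof.
rewrite big_mkcond -(boxsum_path _ _ (leqnn m)) -boxsumE.
by apply: eq_bigr => nu _; rewrite box_partE.
Qed.

End ChainSums.

(** * Peeling one variable off a sum over sign choices *)

(** Side conditions of [field], which come with arbitrary signs and orders of
    the terms. *)
Ltac field_side :=
  repeat (apply/andP; split); rewrite ?oppr_eq0 ?opprK;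
  try assumption; try exact: oner_neq0;
  try (apply: expf_neq0; assumption); try (rewrite mulrC; assumption);
  try (rewrite addrC; assumption); try (rewrite addrC mulrC; assumption);
  try (rewrite mulNr mulrC; assumption).

Section SignSumForms.
Variable F : fieldType.
Implicit Types (a b g c : F -> F) (t : F).

Lemma eq_peel n g (x : 'I_n.+1 -> F) f f' :
  (forall j, f (x \o lift j) = f' (x \o lift j)) -> peel g x f = peel g x f'.
Proof. by move=> H; apply: eq_bigr => j _; rewrite H. Qed.

Lemma peelZ n g (x : 'I_n.+1 -> F) k f :
  peel (fun z => k * g z) x f = k * peel g x f.
Proof. by rewrite mulr_sumr; apply: eq_bigr => j _; rewrite !mulrA. Qed.

Lemma peel_mul n g (x : 'I_n.+1 -> F) k f :
  peel g x (fun y => k * f y) = k * peel g x f.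
Proof. by rewrite mulr_sumr; apply: eq_bigr => j _; rewrite mulrCA. Qed.

Lemma peel_chainsum n m g (x : 'I_n.+1 -> F) M f :
  chainsum m M (fun s => peel g x (f s)) =
  peel g x (fun y => chainsum m M (fun s => f s y)).
Proof.
rewrite /peel chainsum_sum; apply: eq_bigr => j _.
by rewrite chainsumZ.
Qed.

Lemma schurx0 (x : 'I_0 -> F) s : schurx x s = 1.
Proof. by rewrite /schurx det_mx00 /vandermonde big_ord0 divr1. Qed.

Lemma generic0 (x : 'I_0 -> F) : generic x.
Proof. by split=> -[]. Qed.

Lemma sign_sum0 (x : 'I_0 -> F) a b : sign_sum x a b = 1.
Proof.
have := sign_sum_det a b (generic0 x).
by rewrite /vandermonde big_ord0 mul1r det_mx00.
Qed.

(** The shape of all recursions below: the weight of a chain is a factor for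
    its largest entry times the weight of the rest. *)
Lemma chainsum_peel n (x : 'I_n.+1 -> F) M (w : seq nat -> F)
    (k : nat -> F) (w' : nat -> seq nat -> F) : generic x ->
  (forall v s, size s = n -> path geq v s -> (v <= M)%N ->
     w (v :: s) = k v * w' v s) ->
  chainsum n.+1 M (fun s => w s * schurx x s) =
  \sum_(v < M.+1) k v *
     peel (fun z => z ^+ v) x
       (fun y => chainsum n v (fun s => w' v s * schurx y s)).
Proof.
move=> gx H; rewrite [LHS]/=; apply: eq_bigr => v _.
rewrite -(peel_chainsum _ _ _ _ (fun s y => w' v s * schurx y s)).
rewrite -(chainsumZ n v (k v)).
apply: eq_chainsum => s sn vs; rewrite (H v s sn vs); last by rewrite -ltnS ltn_ord.
rewrite (schurx_cons _ _ gx).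
by rewrite peel_mul mulrA.
Qed.

Lemma sign_sum_mul n (x : 'I_n -> F) (U : {set 'I_n}) a b c :
  \prod_i (if i \in U then a (x i) else b (x i)) * \prod_(i in U) c (x i) =
  \prod_i (if i \in U then a (x i) * c (x i) else b (x i)).
Proof.
rewrite [X in _ * X]big_mkcond -big_split; apply: eq_bigr => i _ /=.
by case: ifP; rewrite ?mulr1.
Qed.

(** A sum over sign choices with a further weight on U, in which the outcome
    of [peel] is expressed before the weight is evaluated. *)
Definition wsign_sum n (x : 'I_n -> F) a b (W : {set 'I_n} -> F) :=
  \sum_(U : {set 'I_n})
    sign_weight x U * \prod_i (if i \in U then a (x i) else b (x i)) * W U.

Lemma peel_wsign_sum n g (x : 'I_n.+1 -> F) a b : generic x ->
  (forall i, a (x i) != 0) ->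
  peel g x (fun y => sign_sum y a b) =
  wsign_sum x a b (fun U => \sum_(j in U) g (x j) / a (x j) *
                 \prod_(i in U | i != j) cross x j i).
Proof.
move=> gx ha; rewrite peel_sign_sum //; apply: eq_bigr => U _.
rewrite -!mulrA; congr (_ * _).
have -> : \prod_i (if i \in U then a (x i) else b (x i)) =
    \prod_(i in U) a (x i) * \prod_(i | i \notin U) b (x i).
  rewrite (bigID (mem U)) /=; congr (_ * _); apply: eq_bigr => i; first by move=> ->.
  by move/negbTE ->.
rewrite -[RHS]mulrA [RHS]mulrCA; congr (_ * _).
rewrite mulr_sumr; apply: eq_bigr => j jU.
rewrite [\prod_(i in U) a (x i)](bigD1 j jU) /= big_split /=.
set A := \prod_(_ in _ | _) _; set B := \prod_(_ in _ | _) _.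
by field; apply: ha.
Qed.

Lemma eq_wsign_sum n (x : 'I_n -> F) a b W W' :
  (forall U, W U = W' U) -> wsign_sum x a b W = wsign_sum x a b W'.
Proof. by move=> H; apply: eq_bigr => U _; rewrite H. Qed.

Lemma wsign_sum1 n (x : 'I_n -> F) a b : wsign_sum x a b (fun=> 1) = sign_sum x a b.
Proof. by apply: eq_bigr => U _; rewrite mulr1. Qed.

Lemma wsign_sumB n (x : 'I_n -> F) a b W W' :
  wsign_sum x a b (fun U => W U - W' U) = wsign_sum x a b W - wsign_sum x a b W'.
Proof. by rewrite /wsign_sum -sumrB; apply: eq_bigr => U _; rewrite mulrBr. Qed.

Lemma wsign_sumD n (x : 'I_n -> F) a b W W' :
  wsign_sum x a b (fun U => W U + W' U) = wsign_sum x a b W + wsign_sum x a b W'.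
Proof. by rewrite /wsign_sum -big_split; apply: eq_bigr => U _; rewrite mulrDr. Qed.

Lemma wsign_sumZ n (x : 'I_n -> F) a b k W :
  wsign_sum x a b (fun U => k * W U) = k * wsign_sum x a b W.
Proof. by rewrite /wsign_sum mulr_sumr; apply: eq_bigr => U _; rewrite mulrCA. Qed.

Lemma wsign_sum_prod n (x : 'I_n -> F) a b c a' :
  (forall i, a (x i) * c (x i) = a' (x i)) ->
  wsign_sum x a b (fun U => \prod_(i in U) c (x i)) = sign_sum x a' b.
Proof.
move=> H; apply: eq_bigr => U _; rewrite -mulrA sign_sum_mul; congr (_ * _).
by apply: eq_bigr => i _; rewrite H.
Qed.

Lemma sign_sumN n (x : 'I_n -> F) a b :
  sign_sum x (fun z => - a z) b = (-1) ^+ n * sign_sum x a (fun z => - b z).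
Proof.
rewrite /sign_sum mulr_sumr; apply: eq_bigr => U _; rewrite mulrCA; congr (_ * _).
rewrite -[n in _ ^+ n]card_ord -prodr_const -big_split; apply: eq_bigr => i _ /=.
by case: ifP; rewrite mulN1r ?opprK.
Qed.

Lemma theta_neq n (x : 'I_n -> F) : generic x ->
  forall i j, i != j -> theta (x i) != theta (x j).
Proof.
case=> h1 h2 h3 i j ij; rewrite -subr_eq0.
have -> : theta (x i) - theta (x j) = (x i - x j) * (x i * x j - 1) / (x i * x j).
  by rewrite /theta; field; rewrite !h1.
by rewrite !mulf_neq0 ?invr_neq0 ?subr_eq0 ?h2 // mulf_neq0.
Qed.

(** Gives the second initial value of the second order recursion, and
    the value before m = 0 in the even orthogonal case. *)
Lemma sign_sum_proportional_rows n (x : 'I_n -> F) a b (k l : 'I_n) (e : F) : generic x ->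
  k != l ->
  (forall j, a (x j) * x j ^+ (n - k.+1) + b (x j) * x j ^- (n - k.+1) =
     e * (a (x j) * x j ^+ (n - l.+1) + b (x j) * x j ^- (n - l.+1))) ->
  sign_sum x a b = 0.
Proof.
move=> gx kl H; apply: (mulfI (vandermonde_neq0 (theta_neq gx))).
rewrite mulr0 sign_sum_det //; set M := \matrix_(i, j) _.
pose B := \matrix_(i, j) (if i == k then M l j else M i j).
have rB : row' k B = row' k M.
  by apply/matrixP => i j; rewrite !mxE eq_sym (negbTE (neq_lift _ _)).
have rM : row k M = e *: row k B + 0 *: row k B.
  by apply/rowP => j; rewrite !mxE eqxx mul0r addr0 -H.
rewrite (determinant_multilinear rM rB rB) mul0r addr0.
rewrite (determinant_alternate kl) ?mulr0 // => j.
by rewrite !mxE eqxx eq_sym (negbTE kl).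
Qed.

Lemma wsign_sum_residue n (x : 'I_n -> F) a b r a' : generic x ->
  (forall i, x i != r) ->
  (forall i, a (x i) * ((r - (x i)^-1) / (r - x i)) = a' (x i)) ->
  wsign_sum x a b (fun U => \sum_(j in U) (x j - (x j)^-1) / (x j - r) *
                 \prod_(i in U | i != j) cross x j i) =
  sign_sum x a b - sign_sum x a' b.
Proof.
move=> gx hr ha.
rewrite (@eq_wsign_sum _ _ _ _ _ _ (fun U => residue_sum gx (fun i _ => hr i))).
rewrite wsign_sumB wsign_sum1; congr (_ - _).
exact: (@wsign_sum_prod _ _ _ _ (fun z => (r - z^-1) / (r - z))).
Qed.

(** When g/a has two poles besides the x_i, each of them contributes one
    sum over sign choices. *)
Lemma peel_residue2 n g (x : 'I_n.+1 -> F) a b k1 r1 a1 k2 r2 a2 : generic x ->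
  (forall i, a (x i) != 0) ->
  (forall i, x i != r1) -> (forall i, x i != r2) ->
  (forall i, g (x i) / a (x i) =
     (x i - (x i)^-1) * (k1 / (x i - r1) + k2 / (x i - r2))) ->
  (forall i, a (x i) * ((r1 - (x i)^-1) / (r1 - x i)) = a1 (x i)) ->
  (forall i, a (x i) * ((r2 - (x i)^-1) / (r2 - x i)) = a2 (x i)) ->
  peel g x (fun y => sign_sum y a b) =
  (k1 + k2) * sign_sum x a b - k1 * sign_sum x a1 b - k2 * sign_sum x a2 b.
Proof.
move=> gx ha hr1 hr2 hg h1 h2; rewrite peel_wsign_sum //.
transitivity (k1 * (sign_sum x a b - sign_sum x a1 b) +
              k2 * (sign_sum x a b - sign_sum x a2 b)); last by ring.
rewrite -(wsign_sum_residue _ gx hr1 h1) -(wsign_sum_residue _ gx hr2 h2).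
rewrite -!wsign_sumZ -wsign_sumD; apply: eq_wsign_sum => U.
rewrite !mulr_sumr -big_split; apply: eq_bigr => j _; rewrite hg /=; ring.
Qed.

Lemma peel_residue n g (x : 'I_n.+1 -> F) a b r a' : generic x ->
  (forall i, a (x i) != 0) -> (forall i, x i != r) ->
  (forall i, g (x i) / a (x i) = (x i - (x i)^-1) / (x i - r)) ->
  (forall i, a (x i) * ((r - (x i)^-1) / (r - x i)) = a' (x i)) ->
  peel g x (fun y => sign_sum y a b) = sign_sum x a b - sign_sum x a' b.
Proof.
move=> gx ha hr hg h; rewrite peel_wsign_sum // -(wsign_sum_residue _ gx hr h).
by apply: eq_wsign_sum => U; apply: eq_bigr => j _; rewrite hg.
Qed.

Lemma generic_neq1 n (x : 'I_n -> F) : generic x ->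
  forall i, x i - 1 != 0 /\ x i + 1 != 0.
Proof.
case=> _ _ h3 i; have h := h3 i i; split; apply: contra h.
  by rewrite subr_eq0 => /eqP ->; rewrite mulr1.
by rewrite addr_eq0 => /eqP ->; rewrite mulrNN mulr1.
Qed.

Lemma oppD_neq0 (u v : F) : u + v != 0 -> - u - v != 0.
Proof. by rewrite -opprD oppr_eq0. Qed.
Lemma subC_neq0 (u v : F) : u - v != 0 -> v - u != 0.
Proof. by rewrite -oppr_eq0 opprB. Qed.

(** With [B_minus], the factors z^w / (z - 1) and 1 / (1 - z) come from
    dividing x^(+-(c + 1/2)) by x^(1/2) - x^(-1/2) and multiplying by x^c; the
    rectangle with 2c = m is w = m + 1, which makes w = 0 the empty sum. *)
Definition B_plus (w : nat) (z : F) := z ^+ w / (z - 1).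
Definition B_minus (z : F) := (1 - z)^-1.

Lemma B_plus_neq0 n (x : 'I_n -> F) : generic x -> forall w i, B_plus w (x i) != 0.
Proof.
move=> gx w i; have [h1 _ _] := gx; have [z1 _] := generic_neq1 gx i.
by rewrite mulf_neq0 ?expf_neq0 ?invr_neq0.
Qed.

(** g/a = (1 - 1/z) = (z - 1/z) / (z + 1): the only further pole is -1, and it
    contributes the product of the 1/x_i, which lowers the exponent by one. *)
Lemma peel_B n (x : 'I_n.+1 -> F) m : generic x ->
  peel (fun z => z ^+ m) x (fun y => sign_sum y (B_plus m.+1) B_minus) =
  sign_sum x (B_plus m.+1) B_minus - sign_sum x (B_plus m) B_minus.
Proof.
move=> gx; have [h1 h2 h3] := gx; have hz := generic_neq1 gx.
apply: (@peel_residue _ _ _ _ _ (-1)) => // [|i|i|i]; first exact: B_plus_neq0.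
all: have [z1 z2] := hz i; have hi := h1 i.
- by rewrite -subr_eq0 opprK.
- by rewrite /B_plus exprS; field; field_side.
have := @oppD_neq0 1 (x i); rewrite addrC z2 => /(_ isT) z3.
by rewrite /B_plus exprS; field; field_side.
Qed.

(** [B_plus] with the exponent shifted once more, since a second order
    recursion needs two values before m = 0. *)
Definition B_plus2 (w : nat) (z : F) := z ^+ w / (z * (z - 1)).

(** The factor 1 - t/z turns the recursion in m into one with
    characteristic roots 1 and t; its poles are -1 and 0. *)
Lemma peel_B_adjoin n (x : 'I_n.+1 -> F) t m : generic x ->
  peel (fun z => z ^+ m * (1 - t / z)) x (fun y => sign_sum y (B_plus2 m.+2) B_minus) =
  sign_sum x (B_plus2 m.+2) B_minus - (1 + t) * sign_sum x (B_plus2 m.+1) B_minus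
   + t * sign_sum x (B_plus2 m) B_minus.
Proof.
move=> gx; have [h1 h2 h3] := gx; have hz := generic_neq1 gx.
rewrite (@peel_residue2 _ _ _ _ _ (1 + t) (-1) (B_plus2 m.+1) (- t) 0 (B_plus2 m)) //.
- by ring.
all: move=> i; have [z1 z2] := hz i; have hi := h1 i.
all: have := @oppD_neq0 1 (x i); rewrite addrC z2 => /(_ isT) z3.
- by rewrite /B_plus2 mulf_neq0 ?expf_neq0 ?invr_neq0 ?mulf_neq0.
- by rewrite -subr_eq0 opprK.
- by rewrite /B_plus2 !exprS; field; field_side.
- by rewrite /B_plus2 !exprS; field; field_side.
- by rewrite /B_plus2 !exprS; field; field_side.
Qed.

(** One formula for both parities of m = w - 1: an odd m corresponds to the
    product of the rectangle m - 1 with all the factors 1 + t x_i. *)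
Definition C_plus t (w : nat) (z : F) :=
  z ^+ w * (if odd w then z + t else 1 + t * z) / ((z - 1) * (z + 1)).
Definition C_minus t (z : F) := (1 + t * z) / ((1 - z) * (z + 1)).

(** The poles -t and -1/t avoid 0, the x_i and -1. *)
Definition good_parameter n t (x : 'I_n -> F) : Prop :=
  [/\ t != 0, t != 1, (forall i, x i + t != 0) & (forall i, 1 + t * x i != 0)].

(** The pole is -t for even m and -1/t for odd m; its contribution exchanges
    x + t and 1 + t x, that is, it switches the parity. *)
Lemma peel_C n t (x : 'I_n.+1 -> F) m : generic x -> good_parameter t x ->
  peel (fun z => (if odd m then t else 1) * z ^+ m) x
    (fun y => sign_sum y (C_plus t m.+1) (C_minus t)) =
  sign_sum x (C_plus t m.+1) (C_minus t) - sign_sum x (C_plus t m) (C_minus t).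
Proof.
move=> gx [t0 t1 ht1 ht2]; have [h1 h2 h3] := gx; have hz := generic_neq1 gx.
rewrite /C_plus /=; case: (odd m) => /=.
- apply: (@peel_residue _ _ _ _ _ (- t^-1)) => // i;
    have [z1 z2] := hz i; have hi := h1 i; have u1 := ht1 i; have u2 := ht2 i;
    have u5 : x i * t + 1 != 0 by rewrite mulrC addrC.
  + by do 3?[rewrite ?mulf_neq0 ?expf_neq0 ?invr_neq0 //].
  + apply: contra u2 => /eqP ->; by rewrite mulrN divff // subrr.
  + by rewrite !exprS; field; field_side.
  + have u3 : -1 - t * x i != 0 by apply: oppD_neq0.
    by rewrite !exprS; field; field_side.
- apply: (@peel_residue _ _ _ _ _ (- t)) => // i;
    have [z1 z2] := hz i; have hi := h1 i; have u1 := ht1 i; have u2 := ht2 i;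
    have u5 : x i * t + 1 != 0 by rewrite mulrC addrC.
  + by do 3?[rewrite ?mulf_neq0 ?expf_neq0 ?invr_neq0 //].
  + by rewrite -subr_eq0 opprK.
  + by rewrite !exprS; field; field_side.
  + have u3 : - t - x i != 0 by apply: oppD_neq0; rewrite addrC.
    by rewrite !exprS; field; field_side.
Qed.

(** [Bt_plus] belongs to the chains without the value 2m - 1, [Et_plus] to all
    chains bounded by 2m - 1, which are governed by the Pieri rule. *)
Definition Bt_plus t (m : nat) (z : F) := z ^+ m * (z + t) / (z - 1).
Definition Et_plus t (m : nat) (z : F) := z ^+ m * (1 + t * z) / (z - 1).
Definition Bt_minus t (z : F) := (1 + t * z) / (1 - z).

(** Either side has the poles -1 and -t or -1/t, and the contributions are
    the same two sums.  The identity is what one gets by removing the chains with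
    largest entry 2m on one side and 2m - 1 on the other. *)
Lemma peel_B_vstrips n t (x : 'I_n.+1 -> F) m : generic x -> good_parameter t x ->
  sign_sum x (Bt_plus t m) (Bt_minus t) -
    peel (fun z => z ^+ m) x (fun y => sign_sum y (Bt_plus t m) (Bt_minus t)) =
  sign_sum x (Et_plus t m) (Bt_minus t) -
    t * peel (fun z => z ^+ m) x (fun y => sign_sum y (Et_plus t m) (Bt_minus t)).
Proof.
move=> gx [t0 t1 ht1 ht2]; have [h1 h2 h3] := gx; have hz := generic_neq1 gx.
have t1' : 1 - t != 0 by rewrite subr_eq0 eq_sym.
have t1'' : t - 1 != 0 by rewrite subr_eq0.
pose gA1 z := Bt_plus t m z / z; pose hA1 z := Et_plus t m z / z.
rewrite (@peel_residue2 _ _ _ _ _ (1 - t)^-1 (-1) gA1 (- t / (1 - t)) (- t) hA1) //.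
rewrite (@peel_residue2 _ _ _ (Et_plus t m) _ (t^-1 / (1 - t^-1)) (-1) hA1
           (- t^-1 * t^-1 / (1 - t^-1)) (- t^-1) gA1) //.
- by field; field_side.
all: move=> i; have [z1 z2] := hz i; have hi := h1 i; have u1 := ht1 i;
  have u2 := ht2 i.
all: have := @oppD_neq0 1 (x i); rewrite addrC z2 => /(_ isT) z3.
all: have u3 : -1 - t * x i != 0 by apply: oppD_neq0.
all: have u4 : - t - x i != 0 by apply: oppD_neq0; rewrite addrC.
all: have u5 : t * x i + 1 != 0 by rewrite addrC.
- by do 3?[rewrite ?mulf_neq0 ?expf_neq0 ?invr_neq0 //].
- by rewrite -subr_eq0 opprK.
- apply: contra u2 => /eqP ->; by rewrite mulrN divff // subrr.
- by rewrite /Et_plus; field; field_side.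
- by rewrite /hA1 /Et_plus; field; field_side.
- by rewrite /gA1 /Bt_plus /Et_plus; field; field_side.
- by do 3?[rewrite ?mulf_neq0 ?expf_neq0 ?invr_neq0 //].
- by rewrite -subr_eq0 opprK.
- by rewrite -subr_eq0 opprK.
- by rewrite /Bt_plus; field; field_side.
- by rewrite /gA1 /Bt_plus; field; field_side.
- by rewrite /hA1 /Bt_plus /Et_plus; field; field_side.
Qed.

Definition D_plus (w : nat) (z : F) := z ^+ w / z.

(** The half sum keeps the sign choices with an even number of inversions,
    those of the Weyl group of type D. *)
Definition even_sign_sum n (x : 'I_n -> F) (w : nat) :=
  (sign_sum x (D_plus w) (fun=> 1) + sign_sum x (D_plus w) (fun=> -1)) / 2.

(** The poles 1 and -1 contribute the products of the -1/x_i and of the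
    1/x_i; on an even number of inversions they combine according to the parity of
    the number of variables. *)
Lemma peel_D_adjoin n t (x : 'I_n.+1 -> F) m : (2 : F) != 0 -> generic x ->
  peel (fun z => z ^+ m * (1 - t / z)) x (fun y => even_sign_sum y m.+1) =
  even_sign_sum x m.+1 - (if odd n then 1 else t) * even_sign_sum x m.
Proof.
move=> h2F gx; have [h1 h2 h3] := gx; have hz := generic_neq1 gx.
have sb b : peel (fun z => z ^+ m * (1 - t / z)) x (fun y => sign_sum y (D_plus m.+1) b) =
  sign_sum x (D_plus m.+1) b - (1 - t) / 2 * ((-1) ^+ n.+1 * sign_sum x (D_plus m) (fun z => - b z))
     - (1 + t) / 2 * sign_sum x (D_plus m) b.
{ rewrite -sign_sumN.
  rewrite (@peel_residue2 _ _ _ _ _ ((1 - t) / 2) 1 (fun z => - D_plus m z)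
     ((1 + t) / 2) (-1) (D_plus m)) //.
  - by field.
  all: move=> i; have [z1 z2] := hz i; have hi := h1 i.
  all: have := @oppD_neq0 1 (x i); rewrite addrC z2 => /(_ isT) z3.
  - by do 3?[rewrite ?mulf_neq0 ?expf_neq0 ?invr_neq0 //].
  - by rewrite -subr_eq0.
  - by rewrite -subr_eq0 opprK.
  - by rewrite /D_plus !exprS; field; field_side.
  - have z4 := subC_neq0 z1; by rewrite /D_plus !exprS; field; field_side.
  - by rewrite /D_plus !exprS; field; field_side. }
have -> : peel (fun z => z ^+ m * (1 - t / z)) x (fun y => even_sign_sum y m.+1) =
  (peel (fun z => z ^+ m * (1 - t / z)) x (fun y => sign_sum y (D_plus m.+1) (fun=> 1)) +
   peel (fun z => z ^+ m * (1 - t / z)) x (fun y => sign_sum y (D_plus m.+1) (fun=> -1))) / 2.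
  rewrite /even_sign_sum /peel -big_split mulr_suml; apply: eq_bigr => j _ /=; ring.
rewrite !sb /even_sign_sum opprK exprS -signr_odd.
by case: (odd n) => /=; field.
Qed.

End SignSumForms.
Arguments B_minus {F} z.

(** * Sums of Schur polynomials as sums over sign choices *)

Section ClosedForms.
Variable F : fieldType.
Implicit Types (a b g : F -> F) (t : F).

Lemma sign_sum_zero_row n (x : 'I_n -> F) a b (k : 'I_n) : generic x ->
  (forall j, a (x j) * x j ^+ (n - k.+1) + b (x j) * x j ^- (n - k.+1) = 0) ->
  sign_sum x a b = 0.
Proof.
move=> gx H; apply: (mulfI (vandermonde_neq0 (theta_neq gx))).
rewrite mulr0 sign_sum_det // (expand_det_row _ k) big1 // => j _.
by rewrite mxE H mul0r.
Qed.

Lemma first_order (u L : nat -> F) c : u 0%N = 0 ->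
  (forall w, u w.+1 - c * u w = L w) ->
  forall M, u M.+1 = \sum_(v < M.+1) c ^+ (M - v) * L v.
Proof.
move=> u0 H; elim=> [|M IHM].
  by rewrite big_ord1 subnn expr0 mul1r -H u0 mulr0 subr0.
rewrite big_ord_recr /= subnn expr0 mul1r -H IHM.
have -> : \sum_(v < M.+1) c ^+ (M.+1 - v) * L v =
    c * \sum_(v < M.+1) c ^+ (M - v) * L v.
  rewrite mulr_sumr; apply: eq_bigr => v _.
  by rewrite (subSn (leq_ord v)) exprS mulrA.
ring.
Qed.

Definition qnum t k := \sum_(i < k) t ^+ i.

Lemma qnumS t k : qnum t k.+1 = 1 + t * qnum t k.
Proof.
rewrite /qnum big_ord_recl expr0 mulr_sumr; congr (_ + _).
by apply: eq_bigr => i _; rewrite -exprS.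
Qed.

(** The recursion is composed of the first order ones with the ratios 1
    and t, and composing their solutions produces the q-integers. *)
Lemma second_order (u L : nat -> F) t : u 0%N = 0 -> u 1%N = 0 ->
  (forall w, u w.+2 - (1 + t) * u w.+1 + t * u w = L w) ->
  forall M, u M.+2 = \sum_(v < M.+1) qnum t (M - v).+1 * L v.
Proof.
move=> u0 u1 H.
(* split off the root t; the root 1 remains *)
pose d w := u w.+1 - t * u w.
have d0 : d 0%N = 0 by rewrite /d u0 u1 mulr0 subr0.
have dS w : d w.+1 - 1 * d w = L w by rewrite -H /d; ring.
have E M : u M.+2 = t * u M.+1 + \sum_(v < M.+1) L v.
  have := first_order d0 dS M; under eq_bigr do rewrite expr1n mul1r.
  by rewrite /d => <-; ring.
elim=> [|M IHM].
  by rewrite E u1 mulr0 add0r !big_ord1 subnn qnumS /qnum big_ord0 mulr0 addr0 mul1r.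
rewrite E IHM [X in _ + X]big_ord_recr [RHS]big_ord_recr /= subnn.
rewrite addrA qnumS {3}/qnum big_ord0 mulr0 addr0 mul1r; congr (_ + _).
rewrite mulr_sumr -big_split; apply: eq_bigr => v _ /=.
rewrite (subSn (leq_ord v)) [in RHS]qnumS; ring.
Qed.

(** The sum of all Schur polynomials in the box is the rectangular character
    of type B. *)
Lemma chainsum_B n (x : 'I_n -> F) M : generic x ->
  chainsum n M (schurx x) = sign_sum x (B_plus M.+1) B_minus.
Proof.
elim: n x M => [|n IHn] x M gx; first by rewrite /= schurx0 sign_sum0.
have [h1 h2 h3] := gx.
transitivity (chainsum n.+1 M (fun s => 1 * schurx x s)).
  by apply: eq_chainsum => s _ _; rewrite mul1r.
rewrite (@chainsum_peel _ _ _ _ (fun=> 1) (fun v => 1 ^+ (M - v)) (fun _ _ => 1)) //;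
  last by move=> *; rewrite expr1n mul1r.
symmetry; under eq_bigr => v _.
  rewrite (eq_peel _ (f' := fun y => sign_sum y (B_plus v.+1) B_minus)); last first.
    move=> j; rewrite -IHn; last exact: generic_lift.
    by apply: eq_chainsum => s _ _; rewrite mul1r.
  over.
apply: (first_order (u := fun w => sign_sum x (B_plus w) B_minus)
  (L := fun v => peel (fun z => z ^+ v) x
     (fun y => sign_sum y (B_plus v.+1) B_minus))) => [|w]; last first.
  by rewrite mul1r -peel_B.
apply: (@sign_sum_zero_row _ _ _ _ ord_max) => // j.
have [z1 _] := generic_neq1 gx j; have z1' := subC_neq0 z1.
by rewrite subnn /B_plus /B_minus !expr0; field; field_side.
Qed.

Lemma good_parameter_lift n t (x : 'I_n.+1 -> F) j : good_parameter t x -> good_parameter t (x \o lift j).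
Proof. by case=> a b c d; split=> // i /=. Qed.

Definition odd_weight t (s : seq nat) := t ^+ count odd s.

Lemma odd_weight_cons t v s : odd_weight t (v :: s) = (if odd v then t else 1) * odd_weight t s.
Proof. by rewrite /odd_weight /=; case: (odd v); rewrite ?exprS ?mul1r. Qed.

(** The recursion starts one step before M = 0, where the numerators cancel
    and the last row of the determinant is zero. *)
Lemma chainsum_C n t (x : 'I_n -> F) M : generic x -> good_parameter t x ->
  chainsum n M (fun s => odd_weight t s * schurx x s) = sign_sum x (C_plus t M.+1) (C_minus t).
Proof.
elim: n x M => [|n IHn] x M gx gt; first by rewrite /= schurx0 sign_sum0 mulr1.
have [h1 h2 h3] := gx.
rewrite (@chainsum_peel _ _ _ _ _ (fun v => if odd v then t else 1)
  (fun _ => odd_weight t)) //; last by move=> *; rewrite odd_weight_cons.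
symmetry; under eq_bigr => v _.
  rewrite (eq_peel _ (f' := fun y => sign_sum y (C_plus t v.+1) (C_minus t))); last first.
    by move=> j; rewrite -IHn //; [exact: generic_lift | exact: good_parameter_lift].
  rewrite -peelZ -[peel _ _ _]mul1r -[X in X * _](expr1n F (M - v)); over.
apply: (first_order (u := fun w => sign_sum x (C_plus t w) (C_minus t))
  (L := fun v => peel (fun z => (if odd v then t else 1) * z ^+ v) x
     (fun y => sign_sum y (C_plus t v.+1) (C_minus t)))) => [|w]; last first.
  by rewrite mul1r -peel_C.
apply: (@sign_sum_zero_row _ _ _ _ ord_max) => // j.
have [z1 z2] := generic_neq1 gx j; have z1' := subC_neq0 z1.
by rewrite subnn /C_plus /C_minus !expr0 /=; field; field_side.
Qed.

(** A chain u stands for the pair of shapes with parts u_i/2 rounded up and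
    rounded down; they differ by a vertical strip whose cells are in the rows with
    u_i odd. *)
Definition rim_summand t n (x : 'I_n -> F) s := odd_weight t s * schurx x (map uphalf s).

Lemma chainsum_zero n M (f : seq nat -> F) :
  (forall s, f s = 0) -> chainsum n M f = 0.
Proof.
move=> H; rewrite -[RHS](mul0r (chainsum n M f)) -chainsumZ.
by apply: eq_chainsum => s _ _; rewrite H mul0r.
Qed.

Lemma rim_summand_peel n t (x : 'I_n.+1 -> F) v M u : generic x -> uphalf u = v ->
  chainsum n M (fun s => rim_summand t x (u :: s)) =
  (if odd u then t else 1) *
    peel (fun z => z ^+ v) x (fun y => chainsum n M (rim_summand t y)).
Proof.
move=> gx uv; rewrite -(peel_chainsum _ _ _ _ (fun s y => rim_summand t y s)).
rewrite -chainsumZ; apply: eq_chainsum => s _ _.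
by rewrite /rim_summand odd_weight_cons /= uv schurx_cons // peel_mul !mulrA.
Qed.

Lemma uphalf_doubleS m : uphalf m.*2.+1 = m.+1.
Proof. by rewrite uphalfE -doubleS doubleK. Qed.

(** A largest entry 2m admits the next entry 2m + 1 at no cost, because
    the shape then violates monotonicity by one and its Schur polynomial is 0. *)
Lemma rim_summand_skip n t (x : 'I_n.+1 -> F) m :
  chainsum n (m.*2).+1 (fun s => rim_summand t x (m.*2 :: s)) =
  chainsum n m.*2 (fun s => rim_summand t x (m.*2 :: s)).
Proof.
case: n x => [|n] x //; rewrite chainsumS [X in _ + X]chainsum_zero ?addr0 // => s.
by rewrite /rim_summand !map_cons uphalf_doubleS uphalf_double schurx_repeat mulr0.
Qed.

(** The Pieri rule for the product of the 1 + t x_i with the sum of the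
    Schur polynomials, by peeling: the entries 2k and 2k + 1 in front contribute
    the two terms of 1 + t x_j. *)
Lemma chainsum_pieri n t (x : 'I_n -> F) m : generic x ->
  chainsum n (m.*2).+1 (rim_summand t x) =
  \prod_i (1 + t * x i) * chainsum n m (schurx x).
Proof.
elim: n x m => [|n IHn] x m gx.
  by rewrite /= big_ord0 /rim_summand !schurx0 /odd_weight /= mulr1.
have key k : chainsum n k.*2 (fun s => rim_summand t x (k.*2 :: s)) +
    chainsum n k.*2.+1 (fun s => rim_summand t x (k.*2.+1 :: s)) =
    \prod_i (1 + t * x i) * chainsum n k (fun s => schurx x (k :: s)).
  rewrite -rim_summand_skip (@rim_summand_peel _ _ _ k _ k.*2) ?uphalf_double //.
  rewrite (@rim_summand_peel _ _ _ k.+1 _ k.*2.+1) ?uphalf_doubleS //.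
  rewrite odd_double /= odd_double /= mul1r.
  have -> : chainsum n k (fun s => schurx x (k :: s)) =
    peel (fun z => z ^+ k) x (fun y => chainsum n k (schurx y)).
    rewrite -(peel_chainsum _ _ _ _ (fun s y => schurx y s)).
    by apply: eq_chainsum => s _ _; rewrite schurx_cons.
  rewrite /peel !mulr_sumr -big_split; apply: eq_bigr => j _ /=.
  rewrite IHn; last exact: generic_lift.
  rewrite (bigD1_ord j) //= exprS; ring.
elim: m => [|m IHm]; first by rewrite chainsumS !chainsum0; apply: (key 0%N).
by rewrite doubleS 2!chainsumS IHm -addrA -doubleS key -mulrDr -chainsumS.
Qed.

Definition avoids (m : nat) (s : seq nat) := all (fun u => u.+1 != m.*2) s.

(** The chains without 2m - 1 and the chains bounded by 2m - 1 coincide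
    below 2m - 1; comparing their largest entries gives the two sides of
    [peel_B_vstrips]. *)
Lemma chainsum_vstrips n t (x : 'I_n -> F) m : generic x -> good_parameter t x ->
  chainsum n m.+1.*2 (fun s => if avoids m.+1 s then rim_summand t x s else 0) =
  sign_sum x (Bt_plus t m.+1) (Bt_minus t).
Proof.
elim: n x => [|n IHn] x gx gt.
  by rewrite /= /rim_summand schurx0 sign_sum0 mulr1.
(* closed form of the sum over all the chains bounded by 2m + 1 *)
have hform k (y : 'I_k -> F) : generic y ->
    chainsum k (m.*2).+1 (rim_summand t y) = sign_sum y (Et_plus t m.+1) (Bt_minus t).
  move=> gy; rewrite chainsum_pieri // chainsum_B // mulr_sumr; apply: eq_bigr => U _.
  rewrite mulrCA; congr (_ * _); rewrite -big_split; apply: eq_bigr => i _ /=.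
  by case: ifP => _; rewrite /Et_plus /Bt_minus /B_plus /B_minus; ring.
have E1 := hform _ _ gx; rewrite chainsumS in E1.
rewrite (@rim_summand_peel _ _ _ m.+1) ?uphalf_doubleS // in E1.
rewrite /= odd_double /= in E1.
rewrite (eq_peel _ (f' := fun y => sign_sum y (Et_plus t m.+1) (Bt_minus t))) in E1; last first.
  by move=> j; apply: hform; exact: generic_lift.
have := peel_B_vstrips m.+1 gx gt; rewrite -{}E1 addrK => /eqP; rewrite subr_eq => /eqP ->.
rewrite doubleS 2!chainsumS [X in _ + X + _]chainsum_zero; last first.
  by move=> s; rewrite /avoids /= doubleS eqxx.
rewrite addr0; congr (_ + _).
  apply: eq_chainsum => s _ hs; rewrite (_ : avoids _ _ = true) //.
  move: hs; rewrite (path_sortedE geq_trans) => /andP[/allP H _].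
  by apply/allP => u /H /=; rewrite doubleS; lia.
transitivity (chainsum n (m.*2).+2
   (fun s => peel (fun z => z ^+ m.+1) x
      (fun y => if avoids m.+1 s then rim_summand t y s else 0))).
  apply: eq_chainsum => s _ _; rewrite /avoids /= -/(avoids _ _) doubleS.
  rewrite (_ : _.+3 != _) /=; last by lia.
  case: ifP => _; last by rewrite /peel big1 // => j _; rewrite mulr0.
  rewrite /rim_summand odd_weight_cons /= odd_double /= mul1r uphalf_double.
  by rewrite schurx_cons // peel_mul.
rewrite (peel_chainsum _ _ _ _ (fun s y => if avoids m.+1 s then rim_summand t y s else 0)).
by apply: eq_peel => j; rewrite -IHn //; [exact: generic_lift | exact: good_parameter_lift].
Qed.

Definition vcons n t (x : 'I_n -> F) : 'I_n.+1 -> F :=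
  fun i => oapp x t (unlift ord0 i).

Lemma vcons0 n t (x : 'I_n -> F) : vcons t x ord0 = t.
Proof. by rewrite /vcons unlift_none. Qed.

Lemma vconsS n t (x : 'I_n -> F) i : vcons t x (lift ord0 i) = x i.
Proof. by rewrite /vcons liftK. Qed.

Lemma vcons_lift n t (x : 'I_n.+1 -> F) j :
  vcons t x \o lift (lift ord0 j) = vcons t (x \o lift j).
Proof.
apply: functional_extensionality => i /=.
case: (unliftP ord0 i) => [k|] ->.
  rewrite vconsS /= (_ : lift _ _ = lift ord0 (lift j k)) ?vconsS //.
  by apply/val_inj; rewrite /= /bump /=; lia.
rewrite vcons0 (_ : lift _ _ = ord0) ?vcons0 //.
by apply/val_inj; rewrite /= /bump /=; lia.
Qed.

Lemma generic_vcons_lift n t (x : 'I_n.+1 -> F) j :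
  generic (vcons t x) -> generic (vcons t (x \o lift j)).
Proof. by move=> /(generic_lift (lift ord0 j)); rewrite vcons_lift. Qed.

Lemma generic_behead n t (x : 'I_n -> F) : generic (vcons t x) -> generic x.
Proof.
move=> /(generic_lift ord0); rewrite (_ : _ \o _ = x) //.
by apply: functional_extensionality => i /=; rewrite vconsS.
Qed.

(** The factor 1 - t/z kills the term of the adjoined variable t and cancels
    its factor in all the other terms, so n variables can be peeled from a sum in
    n + 1 of them. *)
Lemma peel_vcons n t (x : 'I_n.+1 -> F) g f : generic (vcons t x) ->
  peel (fun z => g z * (1 - t / z)) (vcons t x) f =
  peel g x (fun y => f (vcons t y)).
Proof.
case=> h1 h2 h3; rewrite /peel big_ord_recl vcons0.
have t0 : t != 0 by have := h1 ord0; rewrite vcons0.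
rewrite divff // subrr mulr0 !mul0r add0r; apply: eq_bigr => j _.
rewrite vconsS vcons_lift; congr (_ * _); rewrite -mulrA; congr (_ * _).
rewrite big_ord_recl.
have -> : lift (lift ord0 j) ord0 = ord0 by apply/val_inj; rewrite /= /bump /=; lia.
rewrite vcons0 mulrA divff ?mul1r; last first.
  have hj := h1 (lift ord0 j); have := h2 _ _ (neq_lift ord0 j).
  rewrite vcons0 vconsS in hj *; rewrite -subr_eq0 => htj.
  have -> : 1 - t / x j = - (t - x j) / x j by field.
  by rewrite mulf_neq0 ?invr_neq0 ?oppr_eq0.
apply: eq_bigr => i _.
rewrite (_ : lift (lift ord0 j) (lift ord0 i) = lift ord0 (lift j i)) ?vconsS //.
by apply/val_inj; rewrite /= /bump /=; lia.
Qed.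

Lemma sign_sum1 (x : 'I_1 -> F) a b : generic x ->
  sign_sum x a b = a (x ord0) + b (x ord0).
Proof.
move=> gx; have := sign_sum_det a b gx.
rewrite /vandermonde big_ord1 big1 ?mul1r; last by case=> -[] //= i; rewrite ltnn.
by move=> ->; rewrite det_mx11 mxE subnn expr0 invr1 !mulr1.
Qed.

(** Number of the columns of even length in the complement of s in the box
    with M columns, as an alternating sum; see [alt_weight_count]. *)
Fixpoint alt_weight (M : nat) (s : seq nat) : nat :=
  if s is v :: s' then ((if odd (size s') then M - v else 0) + alt_weight v s')%N else M.

(** The ratio of the recursion is t or 1 according to the parity of the
    number of variables, and so is the dependence of [alt_weight] on M. *)
Lemma chainsum_D n t (x : 'I_n -> F) M : (2 : F) != 0 -> generic (vcons t x) ->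
  chainsum n M (fun s => t ^+ alt_weight M s * schurx x s) =
  even_sign_sum (vcons t x) M.+1.
Proof.
move=> h2F; elim: n x M => [|n IHn] x M gx.
  have [h1 _ _] := gx; have := h1 ord0; rewrite vcons0 => t0.
  rewrite /= schurx0 mulr1 /even_sign_sum !sign_sum1 // vcons0 /D_plus exprS; by field; field_side.
have gx' := generic_behead gx.
rewrite (@chainsum_peel _ _ _ _ _ (fun v => (if odd n then t else 1) ^+ (M - v))
  (fun v s => t ^+ alt_weight v s)) //; last first.
  move=> v s sn vs vM; rewrite /= sn exprD; congr (_ * _).
  by case: (odd n); rewrite ?expr0 ?expr1n.
symmetry; under eq_bigr => v _.
  rewrite (eq_peel _ (f' := fun y => even_sign_sum (vcons t y) v.+1)); last first.
    by move=> j; apply: IHn; apply: generic_vcons_lift.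
  rewrite -(peel_vcons _ (fun y => even_sign_sum y v.+1)) //; over.
apply: (first_order (u := even_sign_sum (vcons t x))
  (L := fun v => peel (fun z => z ^+ v * (1 - t / z)) (vcons t x)
     (fun y => even_sign_sum y v.+1))) => [|w]; last first.
  by rewrite peel_D_adjoin //=; case: (odd n).
have [h1 _ _] := gx.
have nmax : ord_max != inord n :> 'I_n.+2.
  by rewrite -val_eqE /= inordK // gtn_eqF.
rewrite /even_sign_sum (sign_sum_proportional_rows (e := 1) gx nmax) => [|j]; last first.
  have hj := h1 j; rewrite inordK // subnn subSnn /D_plus !expr0 expr1; by field; field_side.
rewrite add0r (sign_sum_proportional_rows (e := -1) gx nmax) ?mul0r // => j.
have hj := h1 j; rewrite inordK // subnn subSnn /D_plus !expr0 expr1; by field; field_side.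
Qed.

(** The number, weighted by a power of t, of the sequences interlacing with
    M, s and 0: for each gap between consecutive entries the q-integer of its
    length plus one. *)
Fixpoint strip_weight t (M : nat) (s : seq nat) : F :=
  if s is v :: s' then qnum t (M - v).+1 * strip_weight t v s' else qnum t M.+1.

(** The q-integer for the gap between M and the largest entry is the
    solution kernel of the second order recursion. *)
Lemma chainsum_strip_weight n t (x : 'I_n -> F) M : generic (vcons t x) ->
  chainsum n M (fun s => strip_weight t M s * schurx x s) =
  sign_sum (vcons t x) (B_plus2 M.+2) B_minus.
Proof.
elim: n x M => [|n IHn] x M gx.
  have [h1 _ _] := gx; have := h1 ord0; rewrite vcons0 => t0.
  have [z1 _] := generic_neq1 gx ord0; rewrite vcons0 in z1; have z2 := subC_neq0 z1.
  rewrite /= schurx0 mulr1 sign_sum1 // vcons0.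
  apply: (mulfI z1); rewrite -subrX1 /B_plus2 /B_minus !exprS; by field; field_side.
have gx' := generic_behead gx.
rewrite (@chainsum_peel _ _ _ _ _ (fun v => qnum t (M - v).+1) (strip_weight t)) //.
symmetry; under eq_bigr => v _.
  rewrite (eq_peel _ (f' := fun y => sign_sum (vcons t y) (B_plus2 v.+2) B_minus)); last first.
    by move=> j; apply: IHn; apply: generic_vcons_lift.
  rewrite -(peel_vcons _ (fun y => sign_sum y (B_plus2 v.+2) B_minus)) //; over.
apply: (second_order (u := fun w => sign_sum (vcons t x) (B_plus2 w) B_minus)
  (L := fun v => peel (fun z => z ^+ v * (1 - t / z)) (vcons t x)
     (fun y => sign_sum y (B_plus2 v.+2) B_minus))) => [||w]; last first.
- by rewrite peel_B_adjoin.
- apply: (@sign_sum_zero_row _ _ _ _ ord_max) => // j.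
  have [h1 _ _] := gx; have hj := h1 j.
  have [z1 _] := generic_neq1 gx j; have z1' := subC_neq0 z1.
  by rewrite subnn /B_plus2 /B_minus !expr0 expr1; field; field_side.
have nmax : ord_max != inord n :> 'I_n.+2.
  by rewrite -val_eqE /= inordK // gtn_eqF.
apply: (sign_sum_proportional_rows (e := -1) gx nmax) => j.
have [h1 _ _] := gx; have hj := h1 j.
have [z1 _] := generic_neq1 gx j; have z1' := subC_neq0 z1.
by rewrite inordK // subnn subSnn /B_plus2 /B_minus !expr0 expr1; field; field_side.
Qed.

End ClosedForms.

(** * Determinants with a row deleted or a variable adjoined *)

Section Determinants.
Variable F : fieldType.
Implicit Types (a b g : F -> F) (t : F).

Lemma det_scale_col n (c : 'I_n -> F) (A : 'I_n -> 'I_n -> F) :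
  \det (\matrix_(i, j) (c j * A i j)) = \prod_j c j * \det (\matrix_(i, j) A i j).
Proof.
have -> : \matrix_(i, j) (c j * A i j) = (\matrix_(i, j) A i j) *m diag_mx (\row_j c j).
  by apply/matrixP => i j; rewrite mul_mx_diag !mxE mulrC.
rewrite det_mulmx det_diag mulrC; congr (_ * _).
by apply: eq_bigr => j _; rewrite mxE.
Qed.

Lemma det_add_rows n (A B : 'I_n -> 'I_n -> F) t :
  \det (\matrix_(i, j) (A i j + t * B i j)) =
  \sum_(S : {set 'I_n}) t ^+ #|S| *
    \det (\matrix_(i, j) (if i \in S then B i j else A i j)).
Proof.
rewrite /determinant.
under [RHS]eq_bigr do rewrite mulr_sumr.
rewrite exchange_big; apply: eq_bigr => s _ /=.
under eq_bigr do rewrite mxE addrC.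
rewrite bigA_distr mulr_sumr; apply: eq_bigr => S _; rewrite mulrCA; congr (_ * _).
rewrite -prodr_const [X in _ = X * _]big_mkcond -big_split /=.
by apply: eq_bigr => i _; rewrite mxE; case: ifP; rewrite ?mul1r.
Qed.

Lemma card_ord_ge n i : #|[set j : 'I_n | (i <= j)%N]| = (n - i)%N.
Proof.
rewrite cardsE -sum1_card -(big_geq_mkord i n predT (fun=> 1%N)).
by rewrite sum_nat_const_nat muln1.
Qed.

(** Choosing R_k or R_(k-1) in each row, two rows coincide unless the
    choice of the lower index, once made, persists in the rows below. *)
Lemma det_omit_row n (R : nat -> 'I_n -> F) t :
  \det (\matrix_(i < n, j < n) (R (n - i)%N j + t * R (n - i.+1)%N j)) =
  \sum_(p < n.+1) t ^+ p *
    \det (\matrix_(i < n, j < n) R (if (i < n - p)%N then n - i else n - i.+1)%N j).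
Proof.
rewrite det_add_rows.
rewrite (partition_big (fun S : {set 'I_n} => inord #|S| : 'I_n.+1) predT) //=.
apply: eq_bigr => p _.
pose Sp := [set j : 'I_n | (n - p <= j)%N].
have cSp : #|Sp| = p by rewrite card_ord_ge subKn // -ltnS.
rewrite (bigD1 Sp) /=; last by rewrite cSp inord_val.
rewrite big1 ?addr0 => [|S /andP[/eqP hS neS]].
  rewrite cSp; congr (_ * \det _); apply/matrixP => i j; rewrite !mxE inE.
  by case: leqP.
have {}hS : #|S| = p by rewrite -hS inordK // ltnS -[n in X in (_ <= X)%N]card_ord max_card.
have [up|] := boolP [forall i : 'I_n, forall k : 'I_n, (k == i.+1 :> nat) ==>
                       ((i \in S) ==> (k \in S))].
  have {}up (i k : 'I_n) : (i <= k)%N -> i \in S -> k \in S.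
    case: k => k kn /= ik iS; elim: k kn ik => [|k IHk] kn; rewrite leq_eqVlt.
      by rewrite ltn0 orbF => /eqP e; rewrite (_ : Ordinal kn = i) //; apply/val_inj.
    case/orP => [/eqP e|ik]; first by rewrite (_ : Ordinal kn = i) //; apply/val_inj.
    have /forallP/(_ (Ordinal kn))/implyP/(_ (eqxx _))/implyP :=
      forallP up (Ordinal (ltnW kn)).
    by apply; apply: IHk.
  (* an upward closed set of p indices is the set of the p largest ones *)
  case/negP: neS; apply/eqP/setP => i; rewrite inE; apply/idP/idP => [iS|].
    have : [set j : 'I_n | (i <= j)%N] \subset S.
      by apply/subsetP => j; rewrite inE => ij; apply: up iS.
    move/subset_leq_card; rewrite card_ord_ge hS; have := ltn_ord i; lia.
  apply: contraTT => iS.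
    have : S \subset [set j : 'I_n | (i.+1 <= j)%N].
      apply/subsetP => j jS; rewrite inE ltnNge; apply: contra iS => ji; exact: up jS.
    move/subset_leq_card; rewrite card_ord_ge hS; have := ltn_ord i; lia.
rewrite negb_forall => /existsP[i]; rewrite negb_forall => /existsP[k].
rewrite !negb_imply => /andP[/eqP ki /andP[iS kS]].
rewrite (@determinant_alternate _ _ _ i k) ?mulr0 //.
  by apply: contra kS => /eqP <-.
by move=> j; rewrite !mxE iS (negbTE kS) ki.
Qed.

(** The entries satisfy f_(k+2) = theta(z) f_(k+1) - f_k, so subtracting
    theta(t) times the next row and adding the one after it clears the column of t
    except in the last two rows and leaves theta(x_j) - theta(t) times f in the
    other columns. *)
Lemma det_adjoin n t (x : 'I_n.+1 -> F) a b g :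
  t != 0 -> (forall j, x j != 0) ->
  (let f k z := a z * z ^+ k + b z * z ^- k in
   (forall j, f 1%N t * f 0%N (x j) - f 0%N t * f 1%N (x j) =
              (theta t - theta (x j)) * g (x j)) ->
  \det (\matrix_(i < n.+2, j < n.+2) f (n.+2 - i.+1)%N (vcons t x j)) =
  \prod_j (theta t - theta (x j)) *
    \det (\matrix_(i < n.+1, j < n.+1)
       (if (i < n)%N then f (n.+1 - i.+1)%N (x j) else g (x j)))).
Proof.
move=> t0 x0 f hg.
have rec k z : z != 0 -> f k.+2 z - theta t * f k.+1 z + f k z =
    (theta z - theta t) * f k.+1 z.
  by move=> z0; rewrite /f /theta !exprS; field; rewrite z0 t0 expf_neq0.
(* the row operations, unitriangular *)
pose L : 'M[F]_(n.+2) := \matrix_(i, k)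
  ((i == k)%:R + (if (i < n)%N then
      (k == i.+1 :> nat)%:R * - theta t + (k == i.+2 :> nat)%:R else 0)).
have detL : \det L = 1.
  rewrite -det_tr det_trig.
    rewrite big1 // => i _; rewrite !mxE eqxx.
    by case: ifP => _; rewrite ?(ltn_eqF (ltnSn _)) ?(@ltn_eqF _ i.+2) // ?mul0r ?addr0 ?add0r.
  apply/is_trig_mxP => i k ik; rewrite !mxE.
  have -> : (k == i) = false by apply/eqP => e; rewrite e ltnn in ik.
  rewrite !(@ltn_eqF i) ?mul0r ?addr0 ?if_same ?addr0 //; lia.
set M := \matrix_(i, j) _.
have sel (c : F) (m : nat) j : (m < n.+2)%N ->
    \sum_(k < n.+2) (k == m :> nat)%:R * c * M k j = c * f (n.+2 - m.+1)%N (vcons t x j).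
  move=> hm; rewrite (bigD1 (Ordinal hm)) //= eqxx mul1r big1 => [|k].
    by rewrite addr0 mxE.
  by rewrite -val_eqE /= => /negbTE ->; rewrite !mul0r.
have LM i j : (L *m M) i j =
    if (i < n)%N then (theta (vcons t x j) - theta t) * f (n - i)%N (vcons t x j)
    else f (n.+2 - i.+1)%N (vcons t x j).
  have zj : vcons t x j != 0.
    by case: (unliftP ord0 j) => [k|] ->; rewrite ?vcons0 ?vconsS.
  rewrite mxE; under eq_bigr => k _ do rewrite mxE mulrDl.
  rewrite big_split /= (bigD1 i) //= eqxx mul1r big1 => [|k]; last first.
    by rewrite eq_sym => /negbTE ->; rewrite mul0r.
  rewrite addr0 [M i j]mxE; case: ifP => hi; last first.
    by rewrite big1 ?addr0 // => k _; rewrite mul0r.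
  under eq_bigr => k _ do rewrite mulrDl.
  rewrite big_split /= sel; last by lia.
  under [X in _ + (_ + X) = _]eq_bigr => k _ do rewrite -[(_ == _)%:R]mulr1.
  rewrite sel; last by lia.
  have := rec (n - i).-1 _ zj.
  have -> : (n - i).-1.+2 = (n.+2 - i.+1)%N by lia.
  have -> : (n - i).-1.+1 = (n - i)%N by lia.
  have -> : (n.+2 - i.+2 = n - i)%N by lia.
  have -> : (n.+2 - i.+3 = (n - i).-1)%N by lia.
  by move=> <-; ring.
pose e j := theta (x j) - theta t.
(* the two minors in the column of t differ only in their last row *)
pose D h := \det (\matrix_(i < n.+1, j < n.+1)
   (if (i < n)%N then e j * f (n.+1 - i.+1)%N (x j) else h j)).
have D_lin h1 h2 u v : D (fun j => u * h1 j + v * h2 j) = u * D h1 + v * D h2.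
  rewrite /D; set A := \matrix_(i, j) _; set B := \matrix_(i, j) _.
  set C := \matrix_(i, j) _.
  apply: (@determinant_multilinear _ _ A B C ord_max).
  - by apply/rowP => j; rewrite !mxE /= ltnn.
  - apply/matrixP => i j; rewrite !mxE.
    by rewrite lift_max (ltn_ord i).
  - apply/matrixP => i j; rewrite !mxE.
    by rewrite lift_max (ltn_ord i).
have last_max (i : 'I_n.+1) : (i < n)%N = false -> i = ord_max.
  by move=> h; apply/val_inj => /=; have := ltn_ord i; lia.
have -> : \det M = (-1) ^+ n * D (fun j => f 1%N t * f 0%N (x j) + - f 0%N t * f 1%N (x j)).
  rewrite -[LHS]mul1r -[X in X * _ = _]detL -det_mulmx (expand_det_col _ ord0).
  rewrite 2!big_ord_recr /= big1 => [|i _]; last first.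
    by rewrite LM /= ltn_ord vcons0 subrr !mul0r.
  rewrite add0r !LM /= ltnn ltnNge leqnSn /= vcons0 !subSS subSnn subnn.
  rewrite D_lin mulrDr /cofactor !addn0 exprS.
  set d1 := \det _; set d2 := \det _.
  have -> : d1 = D (f 0%N \o x).
    congr (\det _); apply/matrixP => i j; rewrite [LHS]mxE [LHS]mxE LM [RHS]mxE.
    rewrite vconsS /= /bump; case: (ltnP i n) => hi.
      by rewrite add0n hi !subSS.
    rewrite (_ : 1 + i < n = false)%N; last by lia.
    by rewrite (_ : n.+2 - (1 + i).+1 = 0)%N //; lia.
  have -> : d2 = D (f 1%N \o x).
    congr (\det _); apply/matrixP => i j; rewrite [LHS]mxE [LHS]mxE LM [RHS]mxE.
    rewrite vconsS lift_max; case: (ltnP i n) => hi; first by rewrite subSS.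
    by rewrite (_ : n.+2 - i.+1 = 1)%N //; have := ltn_ord i; lia.
  by rewrite /comp /=; ring.
set G := \det (\matrix_(i < n.+1, j < n.+1) _).
have -> : D (fun j => f 1%N t * f 0%N (x j) + - f 0%N t * f 1%N (x j)) =
    - \prod_j e j * G.
  have -> : D (fun j => f 1%N t * f 0%N (x j) + - f 0%N t * f 1%N (x j)) =
      D (fun j => -1 * (e j * g (x j)) + 0 * 0).
    congr (\det _); apply/matrixP => i j; rewrite !mxE; case: ifP => // _.
    transitivity (f 1%N t * f 0%N (x j) - f 0%N t * f 1%N (x j)); first by ring.
    by rewrite hg /e; ring.
  rewrite D_lin mul0r addr0 mulN1r mulNr /D; congr (- _).
  rewrite -det_scale_col; congr (\det _); apply/matrixP => i j.
  by rewrite !mxE; case: ifP.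
have -> : \prod_j (theta t - theta (x j)) = (-1) ^+ n.+1 * \prod_j e j.
  have -> : (-1) ^+ n.+1 = \prod_(j < n.+1) -1 :> F by rewrite prodr_const card_ord.
  rewrite -big_split.
  by apply: eq_bigr => j _; rewrite /= /e; ring.
by rewrite exprS; ring.
Qed.

End Determinants.

(** * Comparing coefficients of the parameter *)

Section Coefficients.
Variable F : fieldType.
Hypothesis charF : [pchar F] =i pred0.

Lemma natr_neq0 k : (k.+1%:R : F) != 0.
Proof. by rewrite (pcharf0P _).1. Qed.

Lemma natr_inj : injective (fun k => k%:R : F).
Proof.
have H a b : (a%:R : F) = b%:R -> (a <= b)%N -> a = b.
  move=> e ab; apply/eqP; rewrite eqn_leq ab -subn_eq0 -((pcharf0P _).1 charF).
  by rewrite natrB // e subrr /=.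
by move=> a b /= e; case: (leqP a b) => [/H|/ltnW /H h]; [exact | symmetry; exact: h].
Qed.

(** In characteristic 0 the field is infinite; multiplying by the
    X - z for the exceptional z removes the exceptions. *)
Lemma poly_cofinite_eq (bad : seq F) (P Q : {poly F}) :
  (forall t, t \notin bad -> P.[t] = Q.[t]) -> P = Q.
Proof.
move=> H; pose D := (P - Q) * \prod_(z <- bad) ('X - z%:P).
have D0 t : D.[t] = 0.
  rewrite hornerM hornerD hornerN; have [tb|/H ->] := boolP (t \in bad); last first.
    by rewrite subrr mul0r.
  by rewrite horner_prod (big_rem t tb) /= hornerXsubC subrr mul0r mulr0.
have : D = 0.
  apply: (@roots_geq_poly_eq0 _ _ [seq k%:R | k <- iota 0 (size D)]).
  - by apply/allP => z _; rewrite rootE D0.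
  - by rewrite map_inj_uniq ?iota_uniq //; exact: natr_inj.
  - by rewrite size_map size_iota.
move/eqP; rewrite mulf_eq0; case/orP => [|]; first by rewrite subr_eq0 => /eqP.
by rewrite (negbTE (monic_neq0 (monic_prod_XsubC _ _ _))).
Qed.

Lemma coef_cofinite_eq (bad : seq F) N (A B : nat -> F) :
  (forall t, t \notin bad ->
     \sum_(p < N) t ^+ p * A p = \sum_(p < N) t ^+ p * B p) ->
  forall p, (p < N)%N -> A p = B p.
Proof.
move=> H p pN.
suff /(congr1 (fun P : {poly F} => P`_p)) :
  \poly_(i < N) A i = \poly_(i < N) B i by rewrite !coef_poly pN.
apply: (poly_cofinite_eq (bad := bad)) => t /H; rewrite !horner_poly.
by under eq_bigr do rewrite mulrC; under [in RHS]eq_bigr do rewrite mulrC.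
Qed.

Lemma sum_by_weight (I : finType) (P : pred I) (w : I -> nat) N (t : F) (f : I -> F) :
  (forall i, P i -> w i < N)%N ->
  \sum_(i | P i) t ^+ w i * f i =
  \sum_(p < N) t ^+ p * \sum_(i | P i && (w i == p)) f i.
Proof.
move=> H; under [RHS]eq_bigr do rewrite mulr_sumr.
rewrite (exchange_big_dep P) //= => [|p i _ /andP[] //].
apply: eq_bigr => i Pi; rewrite (bigD1 (Ordinal (H i Pi))) ?Pi ?eqxx //=.
rewrite big1 ?addr0 // => p /andP[/eqP wp ne].
by case/negP: ne; rewrite -val_eqE /= wp.
Qed.

End Coefficients.

(** * The character identities, denominators cleared *)

Section CharacterIdentities.
Variable F : fieldType.
Hypothesis charF : [pchar F] =i pred0.
Implicit Types (t : F).

Lemma good_parameter_cofinite n (x : 'I_n -> F) t : generic x ->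
  t \notin [:: 0, 1 & [seq - x i | i <- enum 'I_n] ++ [seq - (x i)^-1 | i <- enum 'I_n]] ->
  good_parameter t x.
Proof.
move=> [h1 _ _]; rewrite !inE mem_cat !negb_or => /and4P[t0 t1 ha hb].
split=> // i; [apply: contra ha | apply: contra hb] => /eqP e; apply/mapP; exists i;
  rewrite ?mem_enum //.
  by apply/eqP; rewrite -addr_eq0 addrC e.
by apply: (mulIf (h1 i)); rewrite mulNr mulVf //; apply/eqP; rewrite -addr_eq0 addrC e.
Qed.

(** The values of t for which t and the x_i together are not generic. *)
Definition vcons_excluded n (x : 'I_n -> F) :=
  [:: 0, 1, -1 & [seq x i | i <- enum 'I_n] ++ [seq (x i)^-1 | i <- enum 'I_n]].

Lemma generic_vcons_cofinite n (x : 'I_n -> F) t : generic x ->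
  t \notin vcons_excluded x -> generic (vcons t x).
Proof.
move=> [h1 h2 h3]; rewrite !inE mem_cat !negb_or => /and5P[t0 t1 tm ha hb].
have hx i : t != x i.
  by apply: contra ha => /eqP ->; apply/mapP; exists i; rewrite ?mem_enum.
have hv i : t * x i != 1.
  apply: contra hb => /eqP e; apply/mapP; exists i; rewrite ?mem_enum //.
  by apply: (mulIf (h1 i)); rewrite mulVf.
split=> [i|i k|i k].
- by case: (unliftP ord0 i) => [j|] ->; rewrite ?vcons0 ?vconsS.
- case: (unliftP ord0 i) => [j|] ->; case: (unliftP ord0 k) => [l|] ->;
    rewrite ?vcons0 ?vconsS // ?(inj_eq lift_inj) ?eqxx //; first exact: h2.
  by move=> _; rewrite eq_sym hx.
- case: (unliftP ord0 i) => [j|] ->; case: (unliftP ord0 k) => [l|] ->;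
    rewrite ?vcons0 ?vconsS //; first by rewrite mulrC.
  by rewrite -expr2 sqrf_eq1 negb_or t1.
Qed.

Lemma vandermonde_vcons n t (x : 'I_n -> F) :
  vandermonde (theta \o vcons t x) = \prod_j (theta t - theta (x j)) * vandermonde (theta \o x).
Proof.
rewrite /vandermonde big_ord_recl /=; congr (_ * _).
  rewrite big_mkcond big_ord_recl /= mul1r vcons0.
  by apply: eq_bigr => i _; rewrite vconsS.
apply: eq_bigr => i _; rewrite big_mkcond big_ord_recl /= mul1r [RHS]big_mkcond.
by apply: eq_bigr => j _; rewrite !vconsS /= /bump /= !add1n ltnS.
Qed.

(** If clearing denominators columnwise makes the entries consecutive rows
    with ratio t, the coefficients of t are the determinants with one row
    omitted. *)
Lemma sign_sum_omit_row n (x : 'I_n -> F) (a b : F -> F) t (fac : 'I_n -> F) (R : nat -> 'I_n -> F) :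
  generic x ->
  (forall k j, fac j * (a (x j) * x j ^+ k + b (x j) * x j ^- k) =
               R k.+1 j + t * R k j) ->
  vandermonde (theta \o x) * \prod_j fac j * sign_sum x a b =
  \sum_(p < n.+1) t ^+ p *
    \det (\matrix_(i < n, j < n) R (if (i < n - p)%N then n - i else n - i.+1)%N j).
Proof.
move=> gx H; rewrite -det_omit_row mulrAC sign_sum_det // mulrC -det_scale_col.
congr (\det _); apply/matrixP => i j; rewrite !mxE H.
by rewrite -subSn // subSS.
Qed.

Definition sdiff n (r : 'I_n -> F) (e : 'I_n -> nat) : F :=
  \det (\matrix_(i < n, j < n) (r j ^+ e i - r j ^- e i)).

Section ColumnIdentities.
Variables (n : nat) (r : 'I_n -> F).
Let x (i : 'I_n) : F := r i ^+ 2.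
Hypothesis gx : generic x.

Lemma r_neq0 i : r i != 0.
Proof. by case: gx => /(_ i); rewrite expf_eq0 /=. Qed.

(** Doubled exponents for the shape (c^(n-p), (c-1)^p): the exponent
    a + 2p is omitted from a, a + 2, ..., a + 2n. *)
Definition colexp (a p : nat) (i : 'I_n) : nat :=
  (a + 2 * (if i < n - p then n - i else n - i.+1))%N.

(** Both sides are the coefficient of t^p of [chainsum_C] at 2c. *)
Lemma C_column_identity c p : (p <= n)%N ->
  vandermonde (theta \o x) * \prod_j ((x j - (x j)^-1) * r j ^- (2 * c)) *
  (\sum_(nu : box n (2 * c) | box_part nu && (count odd (boxseq nu) == p))
     schurx x (boxseq nu)) =
  sdiff r (colexp (2 * c) p).
Proof.
move=> pn; pose C := vandermonde (theta \o x) * \prod_j ((x j - (x j)^-1) * r j ^- (2 * c)).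
pose S q := \sum_(nu : box n (2 * c) | box_part nu && (count odd (boxseq nu) == q))
     schurx x (boxseq nu).
apply: (@coef_cofinite_eq _ charF _ n.+1 (fun q => C * S q)
          (fun q => sdiff r (colexp (2 * c) q)) _ p) => // t tbad.
have gt := good_parameter_cofinite gx tbad.
have := @sign_sum_omit_row n x (C_plus t (2 * c).+1) (C_minus t) t
  (fun j => (x j - (x j)^-1) * r j ^- (2 * c))
  (fun k j => r j ^+ (2 * c + 2 * k) - r j ^- (2 * c + 2 * k)) gx.
rewrite -/C => <-; last first.
  move=> k j; have [z1 z2] := generic_neq1 gx j; have rj := r_neq0 j.
  have xj : x j != 0 by case: gx.
  have z1' := subC_neq0 z1.
  have e q : r j ^+ (2 * q) = x j ^+ q by rewrite exprM.
  have e2 : x j ^+ (2 * c).+1 = x j * (x j ^+ c * x j ^+ c).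
    by rewrite exprS mul2n -addnn exprD.
  rewrite /C_plus /C_minus /= mul2n odd_double -mul2n /= e2 !(exprD _ (2 * c)) !e [x j ^+ k.+1]exprS.
  by field; field_side.
rewrite -chainsum_C // -sum_box_part.
under eq_bigr do rewrite mulrCA; rewrite -mulr_sumr; congr (_ * _).
rewrite (sum_by_weight (w := fun nu => count odd (boxseq nu)) (N := n.+1)) // => nu _.
by rewrite ltnS (leq_trans (count_size _ _)) // size_boxseq.
Qed.

(** Both sides are the coefficient of t^p of [chainsum_vstrips]. *)
Lemma B_column_identity m p : (p <= n)%N ->
  vandermonde (theta \o x) * \prod_j ((r j - (r j)^-1) * r j ^- m.+1) *
  (\sum_(u : box n (m.+1.*2) |
       [&& box_part u, avoids m.+1 (boxseq u) & count odd (boxseq u) == p])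
     schurx x (map uphalf (boxseq u))) =
  sdiff r (colexp m p).
Proof.
move=> pn; pose C := vandermonde (theta \o x) * \prod_j ((r j - (r j)^-1) * r j ^- m.+1).
pose S q := \sum_(u : box n (m.+1.*2) |
       [&& box_part u, avoids m.+1 (boxseq u) & count odd (boxseq u) == q])
     schurx x (map uphalf (boxseq u)).
apply: (@coef_cofinite_eq _ charF _ n.+1 (fun q => C * S q)
          (fun q => sdiff r (colexp m q)) _ p) => // t tbad.
have gt := good_parameter_cofinite gx tbad.
have := @sign_sum_omit_row n x (Bt_plus t m.+1) (Bt_minus t) t
  (fun j => (r j - (r j)^-1) * r j ^- m.+1)
  (fun k j => r j ^+ (m + 2 * k) - r j ^- (m + 2 * k)) gx.
rewrite -/C => <-; last first.
  move=> k j; have [z1 z2] := generic_neq1 gx j; have rj := r_neq0 j.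
  have xj : x j != 0 by case: gx.
  have e q : r j ^+ (2 * q) = x j ^+ q by rewrite exprM.
  have e1 : x j = r j * r j by [].
  have e2 : x j ^+ m.+1 = r j * r j * (r j ^+ m * r j ^+ m).
    by rewrite exprS /x expr2 exprMn.
  rewrite /Bt_plus /Bt_minus e2 !(exprD _ m) !e [x j ^+ k.+1]exprS [r j ^+ m.+1]exprS.
  have z1' := subC_neq0 z1; rewrite e1 in z1 z1' xj.
  by set X := x j ^+ k; rewrite !e1; field; field_side; exact: expf_neq0.
rewrite -chainsum_vstrips // -sum_box_part.
under eq_bigr do rewrite mulrCA; rewrite -mulr_sumr; congr (_ * _).
rewrite -big_mkcondr /rim_summand.
rewrite (sum_by_weight (w := fun u => count odd (boxseq u)) (N := n.+1)) => [|u _].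
  by apply: eq_bigr => q _; congr (_ * _); apply: eq_bigl => u; rewrite andbA.
by rewrite ltnS (leq_trans (count_size _ _)) // size_boxseq.
Qed.

Lemma chainsum_schur0 : chainsum n 0 (schurx x) = 1.
Proof.
have c1 k : chainsum k 0 (fun=> 1 : F) = 1.
  by elim: k => [|k IHk] //; rewrite chainsum0.
rewrite -[RHS](c1 n); apply: eq_chainsum => s sn hs.
have [_ h2 _] := gx.
rewrite /schurx -det_vandermonde; have := vandermonde_neq0 h2.
rewrite -det_vandermonde; set M := \det _; set M' := \det _ => d0.
suff -> : M' = M by rewrite divff.
congr (\det _); apply/matrixP => i j; rewrite !mxE.
move: hs; rewrite (path_sortedE geq_trans) => /andP[/allP H _].
have := H (nth 0%N s i); rewrite mem_nth ?sn // => /(_ isT) /=.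
by rewrite leqn0 => /eqP ->.
Qed.

(** The denominator formula is the rectangle with no columns. *)
Lemma weyl_denominator_B : vandermonde (theta \o x) * \prod_j (r j - (r j)^-1) =
  sdiff r (fun i => (1 + 2 * (n - i.+1))%N).
Proof.
have := sign_sum_det (B_plus 1) B_minus gx.
rewrite -chainsum_B // chainsum_schur0 mulr1 => ->.
rewrite mulrC -det_scale_col; congr (\det _); apply/matrixP => i j; rewrite !mxE.
have [z1 z2] := generic_neq1 gx j; have rj := r_neq0 j; have z1' := subC_neq0 z1.
have xj : x j != 0 by case: gx.
have e q : r j ^+ (2 * q) = x j ^+ q by rewrite exprM.
rewrite exprD e expr1 /B_plus /B_minus expr1; have e1 : x j = r j * r j by [].
set X := x j ^+ _; have X0 : X != 0 by rewrite expf_neq0.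
by rewrite e1 in z1 z1' *; field; field_side.
Qed.

Lemma weyl_denominator_C : vandermonde (theta \o x) * \prod_j (x j - (x j)^-1) =
  sdiff r (fun i => (2 * (n - i))%N).
Proof.
have := @C_column_identity 0 0 isT; rewrite (eq_bigl (@box_part n (2 * 0))); last first.
  move=> nu; rewrite (_ : count _ _ == 0%N) ?andbT // -leqn0 leqNgt -has_count.
  by apply/hasPn => _ /mapP[i _ ->]; case: (nu i) => -[].
rewrite (@sum_box_part F n (2 * 0) (schurx x)) (_ : (2 * 0)%N = 0%N) // chainsum_schur0 mulr1.
under eq_bigr do rewrite expr0 invr1 mulr1.
move=> ->; congr (\det _); apply/matrixP => i j; rewrite !mxE /colexp subn0.
by rewrite ltn_ord.
Qed.

Lemma weyl_denominator_B_neq0 : vandermonde (theta \o x) * \prod_j (r j - (r j)^-1) != 0.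
Proof.
rewrite mulf_neq0 ?(vandermonde_neq0 (theta_neq gx)) //; apply/prodf_neq0 => j _.
have [z1 z2] := generic_neq1 gx j; have rj := r_neq0 j.
have -> : r j - (r j)^-1 = (x j - 1) / r j by rewrite /x; field.
by rewrite mulf_neq0 ?invr_neq0.
Qed.

Lemma weyl_denominator_C_neq0 : vandermonde (theta \o x) * \prod_j (x j - (x j)^-1) != 0.
Proof.
rewrite mulf_neq0 ?(vandermonde_neq0 (theta_neq gx)) //; apply/prodf_neq0 => j _.
have [z1 z2] := generic_neq1 gx j; have xj : x j != 0 by case: gx.
have -> : x j - (x j)^-1 = (x j - 1) * (x j + 1) / x j by field.
by rewrite !mulf_neq0 ?invr_neq0.
Qed.

End ColumnIdentities.

(** The Christoffel-Darboux formula for the two solutions of the recurrence, as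
    two geometric sums, one in t x and one in t and x. *)
Lemma darboux m (b t x : F) : t != 0 -> x != 0 -> b * b = 1 ->
  (t ^+ m * t ^+ 1 + b * t ^- 1) * (x ^+ m * x ^+ 0 + b * x ^- 0) -
  (t ^+ m * t ^+ 0 + b * t ^- 0) * (x ^+ m * x ^+ 1 + b * x ^- 1) =
  (theta t - theta x) *
    \sum_(p < m.+1) t ^+ (m - p) * (x ^+ (m - p) + b * x ^+ p).
Proof.
move=> t0 x0 bb; under eq_bigr do rewrite mulrDr mulrCA -exprMn.
rewrite big_split /= -mulr_sumr.
have := subrXX t x m.+1; set S2 := \sum_(i < m.+1) _ => /= E2.
have := subrX1 (t * x) m.+1.
rewrite (reindex_inj rev_ord_inj) /=.
under eq_bigr do rewrite subSS; set S1 := \sum_(i < m.+1) _ => E1.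
rewrite !expr0 !expr1 invr1 !mulr1.
rewrite !exprS exprMn in E1 E2.
have -> : theta t - theta x = (t - x) * (t * x - 1) / (t * x).
  by rewrite /theta; field; field_side.
transitivity (((t - x) * ((t * x - 1) * S1) + b * (t * x - 1) * ((t - x) * S2)) / (t * x)).
  rewrite -E1 -E2 -[RHS]addr0 -[X in _ = _ + X](mul0r (t^-1 - x^-1)).
  rewrite -(subrr 1) -[X in _ = _ + (X - _) * _]bb; by field; field_side.
by field; field_side.
Qed.

Lemma det_last_row n N (A : 'I_n.+1 -> 'I_n.+1 -> F) (c : 'I_N -> F)
    (H : 'I_N -> 'I_n.+1 -> F) :
  \det (\matrix_(i < n.+1, j < n.+1) (if (i < n)%N then A i j else \sum_p c p * H p j)) =
  \sum_p c p *
    \det (\matrix_(i < n.+1, j < n.+1) (if (i < n)%N then A i j else H p j)).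
Proof.
pose B (h : 'I_n.+1 -> F) : 'M[F]_n.+1 := \matrix_(i, j) (if (i < n)%N then A i j else h j).
have cofE h h' j : cofactor (B h) ord_max j = cofactor (B h') ord_max j.
  rewrite /cofactor; congr (_ * \det _); apply/matrixP => i k; rewrite !mxE.
  by rewrite lift_max (ltn_ord i).
have E h : \det (B h) = \sum_j h j * cofactor (B (fun=> 0)) ord_max j.
  rewrite (expand_det_row _ ord_max); apply: eq_bigr => j _.
  by rewrite mxE /= ltnn (cofE h (fun=> 0)).
rewrite -/(B (fun j => \sum_p c p * H p j)) E.
under [RHS]eq_bigr => p _ do rewrite -/(B (H p)) E mulr_sumr.
rewrite exchange_big; apply: eq_bigr => j _ /=; rewrite mulr_suml.
by apply: eq_bigr => p _; rewrite mulrA.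
Qed.

(** The terms of the Christoffel-Darboux sum in the last row, one
    determinant for each. *)
Lemma det_adjoin_expand n m (b t : F) (x : 'I_n.+1 -> F) :
  b * b = 1 -> t != 0 -> (forall j, x j != 0) ->
  \det (\matrix_(i < n.+2, j < n.+2)
     (vcons t x j ^+ m * vcons t x j ^+ (n.+2 - i.+1) +
      b * vcons t x j ^- (n.+2 - i.+1))) =
  \prod_j (theta t - theta (x j)) *
  \sum_(p < m.+1) t ^+ (m - p) *
    \det (\matrix_(i < n.+1, j < n.+1)
       (if (i < n)%N then x j ^+ m * x j ^+ (n.+1 - i.+1) + b * x j ^- (n.+1 - i.+1)
        else x j ^+ (m - p) + b * x j ^+ p)).
Proof.
move=> bb t0 x0; rewrite -det_last_row.
apply: (@det_adjoin _ n t x (fun z => z ^+ m) (fun=> b)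
  (fun z => \sum_(p < m.+1) t ^+ (m - p) * (z ^+ (m - p) + b * z ^+ p)) t0 x0) => j.
exact: darboux.
Qed.

Lemma alt_weight_le M s : path geq M s -> (alt_weight M s <= M)%N.
Proof.
elim: s M => [|v s IHs] M //= /andP[vM /IHs h]; rewrite /= in vM.
case: ifP => _; last exact: leq_trans h vM.
by rewrite -[X in (_ <= X)%N](subnK vM) leq_add2l.
Qed.

Definition saddz n (r : 'I_n -> F) (e : 'I_n -> int) : F :=
  \det (\matrix_(i < n, j < n) (r j ^ e i + r j ^ (- e i))).

Definition sdiffz n (r : 'I_n -> F) (e : 'I_n -> int) : F :=
  \det (\matrix_(i < n, j < n) (r j ^ e i - r j ^ (- e i))).

Section RowIdentities.
Variables (n : nat) (r : 'I_n.+1 -> F).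
Let x (i : 'I_n.+1) : F := r i ^+ 2.
Hypothesis gx : generic x.

(** Doubled exponents for the shape (c^n, c-p); the last one may be negative. *)
Definition rowexp (m p : nat) (i : 'I_n.+1) : int :=
  if (i < n)%N then (m + 2 * (n.+1 - i.+1))%N%:Z else m%:Z - (2 * p)%N%:Z.

(** b = 1 and b = -1 give the two determinants of type D at once. *)
Definition signdet (b : F) m p : F :=
  \det (\matrix_(i < n.+1, j < n.+1)
           (r j ^ rowexp m p i + b * r j ^ (- rowexp m p i))).

Lemma scale_rows m b p : (p <= m)%N ->
  \prod_j r j ^- m *
    \det (\matrix_(i < n.+1, j < n.+1)
       (if (i < n)%N then x j ^+ m * x j ^+ (n.+1 - i.+1) + b * x j ^- (n.+1 - i.+1)
        else x j ^+ (m - p) + b * x j ^+ p)) = signdet b m p.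
Proof.
move=> pm; rewrite -det_scale_col; congr (\det _); apply/matrixP => i j.
rewrite !mxE /rowexp; have rj := r_neq0 gx j.
have e q : x j ^+ q = r j ^+ q * r j ^+ q by rewrite -exprMn.
case: ifP => _.
  rewrite -invr_expz -exprnP exprD exprM -/(x j) (e m).
  have xk : x j ^+ (n.+1 - i.+1) != 0 by rewrite expf_neq0 // /x expf_neq0.
  have rm : r j ^+ m != 0 by rewrite expf_neq0.
  by set X := x j ^+ _ in xk *; field; field_side.
have rp : r j ^+ p != 0 by rewrite expf_neq0.
have rmp : r j ^+ (m - p) != 0 by rewrite expf_neq0.
have rm : r j ^+ m = r j ^+ (m - p) * r j ^+ p by rewrite -exprD subnK.
have -> : r j ^ (m%:Z - (2 * p)%:Z) = r j ^+ (m - p) / r j ^+ p.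
  rewrite expfzDr // -invr_expz -!exprnP rm mul2n -addnn exprD.
  by field; field_side.
by rewrite -invr_expz expfzDr // -invr_expz -!exprnP rm !e mul2n -addnn exprD; field; field_side.
Qed.

(** In the generating function t^(m-p) belongs to p on either side. *)
Lemma D_row_identity m p : (2 : F) != 0 -> (p <= m)%N ->
  vandermonde (theta \o x) * \prod_j r j ^- m *
  (\sum_(nu : box n.+1 m | box_part nu && (alt_weight m (boxseq nu) == m - p)%N)
     schurx x (boxseq nu)) =
  (saddz r (rowexp m p) + sdiffz r (rowexp m p)) / 2.
Proof.
move=> h2 pm.
have -> : saddz r (rowexp m p) = signdet 1 m p.
  by congr (\det _); apply/matrixP => i j; rewrite !mxE mul1r.
have -> : sdiffz r (rowexp m p) = signdet (-1) m p.
  by congr (\det _); apply/matrixP => i j; rewrite !mxE mulN1r.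
pose C := vandermonde (theta \o x) * \prod_j r j ^- m.
pose S q := \sum_(nu : box n.+1 m | box_part nu && (alt_weight m (boxseq nu) == q)%N)
     schurx x (boxseq nu).
pose V p := (signdet 1 m p + signdet (-1) m p) / 2.
suff H q : (q < m.+1)%N -> C * S q = V (m - q)%N.
  by have := H (m - p)%N; rewrite subKn // => ->; rewrite // ltnS leq_subr.
move: q; apply: (@coef_cofinite_eq _ charF (vcons_excluded x)
  m.+1 (fun q => C * S q) (fun q => V (m - q)%N)) => t tbad.
have gt := generic_vcons_cofinite gx tbad.
have [g1 _ _] := gt; have t0 : t != 0 by have := g1 ord0; rewrite vcons0.
have x0 j : x j != 0 by case: gx.
have P0 : \prod_j (theta t - theta (x j)) != 0.
  by have := vandermonde_neq0 (theta_neq gt); rewrite vandermonde_vcons mulf_eq0 negb_or => /andP[].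
have half b : b * b = 1 ->
  vandermonde (theta \o x) * sign_sum (vcons t x) (D_plus m.+1) (fun=> b) =
  \sum_(p < m.+1) t ^+ (m - p) *
    \det (\matrix_(i < n.+1, j < n.+1)
       (if (i < n)%N then x j ^+ m * x j ^+ (n.+1 - i.+1) + b * x j ^- (n.+1 - i.+1)
        else x j ^+ (m - p) + b * x j ^+ p)).
  move=> bb; apply: (mulfI P0); rewrite -det_adjoin_expand // mulrA -vandermonde_vcons.
  rewrite sign_sum_det //; congr (\det _); apply/matrixP => i j; rewrite !mxE.
  have -> // : D_plus m.+1 (vcons t x j) = vcons t x j ^+ m.
  by rewrite /D_plus exprS mulrC mulKf ?g1.
have half' b : b * b = 1 ->
  C * sign_sum (vcons t x) (D_plus m.+1) (fun=> b) =
  \sum_(p < m.+1) t ^+ (m - p) * signdet b m p.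
  move=> bb; rewrite /C mulrAC half // mulr_suml; apply: eq_bigr => q _.
  by rewrite -scale_rows ?leq_ord // -!mulrA; congr (_ * _); rewrite mulrC.
transitivity (C * even_sign_sum (vcons t x) m.+1).
  rewrite -chainsum_D // -sum_box_part (sum_by_weight (w := fun nu => alt_weight m (boxseq nu))
     (N := m.+1)) => [|nu]; last by rewrite box_partE ltnS; exact: alt_weight_le.
  by rewrite mulr_sumr; apply: eq_bigr => q _; rewrite mulrCA.
rewrite /even_sign_sum mulrA mulrDr !half' ?mulrNN ?mul1r // -big_split mulr_suml.
rewrite (reindex_inj rev_ord_inj); apply: eq_bigr => q _ /=.
by rewrite subSS subKn ?leq_ord // /V; ring.
Qed.

(** The determinants are odd under p -> m + 1 - p, as are the coefficients
    t^(m+1-p) - t^p; the terms with 2p <= m can be read off separately. *)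
Lemma B_row_identity m (B : nat -> F) :
  (forall q, (m < 2 * q)%N -> B q = 0) ->
  (forall t, (t - 1) * chainsum n.+1 m (fun s => strip_weight t m s * schurx x s) =
     \sum_(p < m.+2) (t ^+ (m.+1 - p) - t ^+ p) * B p) ->
  forall p, (2 * p <= m)%N ->
  vandermonde (theta \o x) * \prod_j ((r j - (r j)^-1) * r j ^- m) * B p =
  sdiffz r (rowexp m.+1 p).
Proof.
move=> B0 HB p pm.
have -> : sdiffz r (rowexp m.+1 p) = signdet (-1) m.+1 p.
  by congr (\det _); apply/matrixP => i j; rewrite !mxE mulN1r.
set C := vandermonde _ * _.
have pm1 : (p <= m.+1)%N by lia.
suff H q : (q < m.+2)%N ->
    C * (B (m.+1 - q)%N - B q) = signdet (-1) m.+1 (m.+1 - q)%N.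
  have := H (m.+1 - p)%N; rewrite subKn // [B (m.+1 - p)%N]B0; last by lia.
  by rewrite subr0 => -> //; lia.
move: q; apply: (@coef_cofinite_eq _ charF (vcons_excluded x) m.+2
  (fun q => C * (B (m.+1 - q)%N - B q)) (fun q => signdet (-1) m.+1 (m.+1 - q)%N))
   => t tbad.
have gt := generic_vcons_cofinite gx tbad.
have [g1 _ _] := gt; have t0 : t != 0 by have := g1 ord0; rewrite vcons0.
have x0 j : x j != 0 by case: gx.
have P0 : \prod_j (theta t - theta (x j)) != 0.
  by have := vandermonde_neq0 (theta_neq gt); rewrite vandermonde_vcons mulf_eq0 negb_or => /andP[].
have EC : C = vandermonde (theta \o x) * (\prod_j (x j - 1) * \prod_j r j ^- m.+1).
  rewrite /C; congr (_ * _); rewrite -big_split; apply: eq_bigr => j _ /=.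
  have rj := r_neq0 gx j; have rm : r j ^+ m != 0 by rewrite expf_neq0.
  by rewrite exprS /x expr2; field; field_side.
have key : vandermonde (theta \o x) * (\prod_j (x j - 1)) *
    ((t - 1) * sign_sum (vcons t x) (B_plus2 m.+2) B_minus) =
  \sum_(p < m.+2) t ^+ (m.+1 - p) *
    \det (\matrix_(i < n.+1, j < n.+1)
       (if (i < n)%N then x j ^+ m.+1 * x j ^+ (n.+1 - i.+1) + -1 * x j ^- (n.+1 - i.+1)
        else x j ^+ (m.+1 - p) + -1 * x j ^+ p)).
  apply: (mulfI P0); rewrite -det_adjoin_expand ?mulrNN ?mul1r //.
  have -> : \prod_j (theta t - theta (x j)) * (vandermonde (theta \o x) * \prod_j (x j - 1) *
      ((t - 1) * sign_sum (vcons t x) (B_plus2 m.+2) B_minus)) =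
      \prod_j (vcons t x j - 1) *
        (vandermonde (theta \o vcons t x) * sign_sum (vcons t x) (B_plus2 m.+2) B_minus).
    have -> : \prod_j (vcons t x j - 1) = (t - 1) * \prod_j (x j - 1).
      rewrite big_ord_recl vcons0; congr (_ * _).
      by apply: eq_bigr => j _; rewrite vconsS.
    by rewrite vandermonde_vcons; ring.
  rewrite sign_sum_det // -det_scale_col; congr (\det _); apply/matrixP => i j.
  rewrite !mxE; have [z1 z2] := generic_neq1 gt j; have z0 := g1 j.
  have z1' := subC_neq0 z1; set Z := vcons t x j in z0 z1 z1' z2 *.
  have Zk : Z ^+ (n.+2 - i.+1) != 0 by rewrite expf_neq0.
  by set W := Z ^+ (_ - _) in Zk *; rewrite /B_plus2 /B_minus 2!exprS; field; field_side.
rewrite -chainsum_strip_weight // HB in key.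
transitivity (C * \sum_(p < m.+2) (t ^+ (m.+1 - p) - t ^+ p) * B p).
  under [in RHS]eq_bigr do rewrite mulrBl.
  rewrite sumrB mulrBr [X in _ = _ * X - _](reindex_inj rev_ord_inj) -mulrBr -sumrB mulr_sumr.
  apply: eq_bigr => q _ /=; rewrite subSS subKn ?leq_ord //; ring.
rewrite EC mulrA mulrAC key mulr_suml (reindex_inj rev_ord_inj).
apply: eq_bigr => q _ /=; rewrite subSS subKn ?leq_ord // -scale_rows ?leq_subr //.
by rewrite subKn ?leq_ord // -!mulrA; congr (_ * _); rewrite mulrC.
Qed.

End RowIdentities.
End CharacterIdentities.

(** * Diagrams and parities *)

Section Diagrams.
Variables (n m : nat).
Implicit Types (nu mu : box n m) (D : {set 'I_n * 'I_m}).

Lemma row_lenE D i : row_len D i = #|[set j | (i, j) \in D]|.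
Proof.
have inj : injective (pair i : 'I_m -> 'I_n * 'I_m) by move=> j k [].
rewrite /row_len -(card_imset _ inj).
apply: eq_card => -[k j]; rewrite !inE; apply/andP/imsetP => [[kD /eqP /= ki]|[l]].
  by exists j; rewrite ?inE -?ki.
by rewrite inE => lD [-> ->]; rewrite lD /=.
Qed.

Lemma col_lenE D j : col_len D j = #|[set i | (i, j) \in D]|.
Proof.
have inj : injective (pair^~ j : 'I_n -> 'I_n * 'I_m) by move=> i k [].
rewrite /col_len -(card_imset _ inj).
apply: eq_card => -[i k]; rewrite !inE; apply/andP/imsetP => [[kD /eqP /= ki]|[l]].
  by exists i; rewrite ?inE -?ki.
by rewrite inE => lD [-> ->]; rewrite lD /=.
Qed.

Lemma card_interval a b : (b <= m)%N -> #|[set j : 'I_m | a <= j < b]%N| = (b - a)%N.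
Proof.
move=> bm; rewrite -[RHS]muln1 -sum_nat_const_nat (big_nat_widen _ _ _ _ _ bm).
rewrite big_geq_mkord cardsE -sum1_card; apply: eq_bigl => j.
by rewrite unfold_in /= andbC.
Qed.

Lemma skewE nu mu i j : ((i, j) \in skew nu mu) = (mu i <= j < nu i)%N.
Proof. by rewrite !inE /= -leqNgt. Qed.

Lemma row_len_skew nu mu i : row_len (skew nu mu) i = (nu i - mu i)%N.
Proof.
rewrite row_lenE -(@card_interval (mu i) (nu i)); last by rewrite -ltnS.
by apply: eq_card => j; rewrite [LHS]inE [RHS]inE skewE.
Qed.

Lemma row_len_diagram nu i : row_len (diagram nu) i = nu i.
Proof.
rewrite row_lenE -[RHS]subn0 -(@card_interval 0 (nu i)); last by rewrite -ltnS.
by apply: eq_card => j; rewrite !inE.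
Qed.

Lemma card_skew nu mu : #|skew nu mu| = (\sum_i (nu i - mu i))%N.
Proof.
rewrite -sum1_card (partition_big (fun u => u.1) predT) //=.
apply: eq_bigr => i _; rewrite -row_len_skew /row_len -sum1_card.
by apply: eq_bigl => u; rewrite !inE.
Qed.

Lemma count_boxseq (P : pred nat) nu : count P (boxseq nu) = #|[set i | P (nu i)]|.
Proof.
rewrite count_map -size_filter cardE; congr size; rewrite enumT.
by apply: eq_filter => i; rewrite /= [RHS]inE.
Qed.

Lemma oddrows_diagram nu : oddrows (diagram nu) = count odd (boxseq nu).
Proof.
rewrite count_boxseq /oddrows; apply: eq_card => i.
by rewrite !inE row_len_diagram.
Qed.

End Diagrams.

(** Below column v the first row does not enter; from v on all the rows
    do, so these columns have the parity of the number of rows. *)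
Lemma alt_weight_count M s : path geq M s ->
  alt_weight M s = (\sum_(j < M) ~~ odd (count (leq^~ j) s))%N.
Proof.
elim: s M => [|v s IHs] M /=.
  by move=> _; rewrite sum_nat_const card_ord muln1.
case/andP => vM hs; rewrite (IHs v hs).
rewrite -(big_mkord predT (fun j => nat_of_bool (~~ odd (count (leq^~ j) s)))).
rewrite -(big_mkord predT (fun j => nat_of_bool (~~ odd ((v <= j) + count (leq^~ j) s)))).
rewrite [in RHS](big_cat_nat _ vM) //=.
rewrite addnC; congr (_ + _)%N.
  by rewrite !big_nat; apply: eq_bigr => j /andP[_ jv]; rewrite leqNgt jv.
have -> : (\sum_(v <= j < M) ~~ odd ((v <= j) + count (leq^~ j) s) =
           \sum_(v <= j < M) odd (size s))%N.
  rewrite !big_nat; apply: eq_bigr => j /andP[vj _].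
  rewrite vj /= (_ : count _ s = size s) ?negbK //; apply/eqP; rewrite -all_count.
  move: hs; rewrite path_sortedE; last exact: geq_trans.
  by case/andP => /allP H _; apply/allP => u /H /= uv; apply: leq_trans vj.
by rewrite sum_nat_const_nat; case: (odd _); rewrite ?muln1 ?muln0.
Qed.

Lemma oddcols_alt_weight n m (nu : box n m) : box_part nu ->
  alt_weight m (boxseq nu) = (m - oddcols (skew (box_full n m) nu))%N /\
  (oddcols (skew (box_full n m) nu) <= m)%N.
Proof.
rewrite box_partE => hp.
have E : oddcols (skew (box_full n m) nu) =
    (\sum_(j < m) odd (count (leq^~ j) (boxseq nu)))%N.
  rewrite /oddcols -sum1_card big_mkcond; apply: eq_bigr => j _.
  rewrite !inE col_lenE count_boxseq.
  rewrite (_ : #|[set i | (i, j) \in _]| = #|[set i | (nu i <= j)%N]|).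
    by case: odd.
  by apply: eq_card => i; rewrite inE [RHS]inE skewE ffunE ltn_ord andbT.
have S : (alt_weight m (boxseq nu) + oddcols (skew (box_full n m) nu) = m)%N.
  rewrite alt_weight_count // E -big_split /= -[RHS]muln1 -[X in (X * _)%N]card_ord.
  by rewrite -sum_nat_const; apply: eq_bigr => j _; case: odd.
lia.
Qed.

(** * Vertical strips *)

Section VerticalStrips.
Variable R : comNzRingType.

Lemma sum_card_set (I : finType) (P : pred I) (y : R) :
  #|[set i | P i]|%:R * y = \sum_(i | P i) y.
Proof. by rewrite cardsE sumr_const mulr_natl. Qed.

(** At most one cell per row, and none in the last column: a full row stays
    full. *)
Definition vstrip_cond n m p (nu mu : box n m) : bool :=
  [forall i, (mu i <= nu i <= (mu i).+1)%N && ((nu i == m :> nat) ==> (mu i == m :> nat))]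
  && ((\sum_i (nu i - mu i))%N == p).

Lemma rim_vstripsE n m p (nu : box n m.+1) :
  rim_vstrips p nu = #|[set mu | box_part mu && vstrip_cond p nu mu]|.
Proof.
apply: eq_card => mu; rewrite !inE; congr (_ && _).
rewrite card_skew /vstrip_cond !andbA andbAC; congr (_ && _).
apply/andP/forallP => [[/andP[/forallP hs /forallP hv] /forallP ha] i|H].
  have := hs i; have := hv i; rewrite row_len_skew => h1 h2.
  apply/andP; split; first by apply/andP; split => //; lia.
  apply/implyP => /eqP hm; have := ha (i, ord_max); rewrite skewE hm /= ltnSn eqxx.
  rewrite andbT implybF -ltnNge => h3; rewrite eqn_leq h3 andbT -ltnS; exact: ltn_ord.
split.
  apply/andP; split; apply/forallP => i; have /andP[/andP[h1 h2] _] := H i => //.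
  by rewrite row_len_skew; lia.
apply/forallP => -[i j].
rewrite skewE /=; apply/implyP => /andP[h1 h2]; apply/negP => /eqP [jm].
have /andP[_ /implyP h3] := H i.
have hn : nu i == m.+1 :> nat.
  rewrite eqn_leq; apply/andP; split; first by rewrite -ltnS; exact: ltn_ord.
  by move: h2; rewrite jm.
by have /eqP h4 := h3 hn; move: h1; rewrite h4 jm ltnn.
Qed.

Lemma half_sum a b : (b <= a)%N -> (a <= b.+1)%N ->
  uphalf (a + b) = a /\ (a + b)./2 = b.
Proof. lia. Qed.

Lemma sum_half k : (uphalf k + k./2)%N = k.
Proof. lia. Qed.

Lemma half_near k : (k./2 <= uphalf k <= (k./2).+1)%N.
Proof. lia. Qed.

Lemma half_diff k : (uphalf k - k./2)%N = odd k.
Proof. lia. Qed.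

Lemma half_avoids k m : (k < m.*2.+1)%N ->
  (k.+1 != m.*2) = ((uphalf k == m) ==> (k./2 == m)).
Proof. lia. Qed.

(** The pair of shapes is recovered from u = nu + mu by rounding u/2 up and
    down. *)
Lemma sum_vstrips n m p (f : seq nat -> R) :
  \sum_(nu : box n m.+1 | box_part nu) (rim_vstrips p nu)%:R * f (boxseq nu) =
  \sum_(u : box n m.+1.*2 |
     [&& box_part u, avoids m.+1 (boxseq u) & count odd (boxseq u) == p])
    f (map uphalf (boxseq u)).
Proof.
under eq_bigr do rewrite rim_vstripsE sum_card_set.
rewrite pair_big_dep /=.
pose h (u : box n m.+1.*2) : box n m.+1 * box n m.+1 :=
  ([ffun i => inord (uphalf (u i))], [ffun i => inord (u i)./2]).
pose h' (q : box n m.+1 * box n m.+1) : box n m.+1.*2 :=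
  [ffun i => inord (q.1 i + q.2 i)%N].
have uh (u : box n m.+1.*2) i : (uphalf (u i) < m.+2)%N.
  by have := ltn_ord (u i); rewrite ltnS; lia.
have dh (u : box n m.+1.*2) i : ((u i)./2 < m.+2)%N.
  by have := ltn_ord (u i); rewrite ltnS; lia.
have sh (q : box n m.+1 * box n m.+1) i : (q.1 i + q.2 i < m.+1.*2.+1)%N.
  by have := ltn_ord (q.1 i); have := ltn_ord (q.2 i); rewrite ltnS; lia.
rewrite (reindex_onto h h') /=; last first.
  case=> nu mu /and3P[_ _ /andP[/forallP H _]]; congr (_, _); apply/ffunP => i;
    have /andP[/andP[h1 h2] _] := H i; apply/val_inj;
    have [e1 e2] := half_sum h1 h2; have hs := sh (nu, mu) i;
    by rewrite /= !ffunE /= (inordK hs) ?e1 ?e2 inordK.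
have hh u : h' (h u) = u.
  apply/ffunP => i; apply/val_inj; rewrite /= !ffunE /= (inordK (uh u i)) (inordK (dh u i)).
  by rewrite sum_half (inordK (ltn_ord (u i))).
apply: congr_big => // u; last first.
  move=> _; congr f; rewrite -map_comp; apply: eq_map => i /=.
  by rewrite ffunE inordK.
rewrite hh eqxx andbT /vstrip_cond.
apply/and3P/and3P => [[h1 h2 /andP[/forallP h3 /eqP h4]]|[h1 h2 h3]].
  split.
  - apply/forallP => i; apply/forallP => j; apply/implyP => ij.
    have /forallP/(_ j)/implyP/(_ ij) := forallP h1 i.
    have /forallP/(_ j)/implyP/(_ ij) := forallP h2 i.
    rewrite !ffunE !inordK // => hd hu.
    by rewrite -(sum_half (u j)) -(sum_half (u i)) leq_add.
  - apply/allP => _ /mapP[i _ ->]; have := h3 i.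
    rewrite !ffunE !inordK // => /andP[_].
    by rewrite (half_avoids (ltn_ord (u i))).
  rewrite -h4 count_boxseq -sum1_card big_mkcond; apply/eqP.
  by apply: eq_bigr => i _; rewrite !inE !ffunE !inordK // half_diff; case: odd.
split.
- apply/forallP => i; apply/forallP => j; apply/implyP => ij.
  have /forallP/(_ j)/implyP/(_ ij) := forallP h1 i.
  by rewrite !ffunE !inordK // => hx; rewrite uphalf_leq.
- apply/forallP => i; apply/forallP => j; apply/implyP => ij.
  have /forallP/(_ j)/implyP/(_ ij) := forallP h1 i.
  by rewrite !ffunE !inordK // => hx; rewrite half_leq.
apply/andP; split.
  apply/forallP => i; rewrite !ffunE !inordK // half_near /=.
  rewrite -(half_avoids (ltn_ord (u i))).
  by apply: (allP h2); apply/mapP; exists i; rewrite ?mem_enum.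
rewrite -(eqP h3) count_boxseq -sum1_card [X in _ == X]big_mkcond; apply/eqP.
by apply: eq_bigr => i _; rewrite !inE !ffunE !inordK // half_diff; case: odd.
Qed.

End VerticalStrips.

(** * Horizontal strips and the Clebsch-Gordan rule *)

(** Removal of a horizontal strip in terms of the parts, with the condition on
    its columns read from right to left: l cells removed in a row of length v
    need v + l <= M, and every removed cell costs two columns of the rest. *)
Fixpoint strip (M : nat) (s s' : seq nat) : bool :=
  match s, s' with
  | v :: t, w :: t' => [&& (w <= v)%N, (head 0%N t <= w)%N, (v + (v - w) <= M)%N
                         & strip (M - 2 * (v - w)) t t']
  | [::], [::] => true
  | _, _ => false
  end.

Fixpoint striplen (s s' : seq nat) : nat :=
  match s, s' with
  | v :: t, w :: t' => ((v - w) + striplen t t')%N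
  | _, _ => 0%N
  end.

Lemma path_geq_head v K t : path geq v t -> (head 0%N t <= K)%N -> path geq K t.
Proof. by case: t => //= u t /andP[_ ->] ->. Qed.

Lemma strip_len M s s' : path geq M s -> strip M s s' -> (2 * striplen s s' <= M)%N.
Proof.
elim: s M s' => [|v s IHs] M [|w s'] //= /andP[vM vs] /and4P[wv sw vwM hs].
have := IHs (M - 2 * (v - w))%N s'; rewrite hs (path_geq_head vs) //; last lia.
by move=> /(_ isT isT); lia.
Qed.

Section HorizontalStrips.
Variable F : fieldType.
Implicit Types t : F.

Definition strip_weight_tail t (s : seq nat) : F := if s is v :: s' then strip_weight t v s' else 1.

Lemma strip_weightE t M s : strip_weight t M s = qnum t (M - head 0%N s).+1 * strip_weight_tail t s.
Proof. by case: s => [|v s] //=; rewrite subn0 mulr1. Qed.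

Lemma qnum_geom t k : (t - 1) * qnum t k = t ^+ k - 1.
Proof. by rewrite subrX1. Qed.

(** The characters of a tensor product of two irreducible modules of
    sl_2, multiplied by t - 1: the sums telescope. *)
Lemma clebsch_gordan t h d :
  (t - 1) * (qnum t h.+1 * qnum t d.+1) =
  \sum_(l < (minn h d).+1) (t ^+ ((h + d).+1 - l) - t ^+ l).
Proof.
wlog hd : h d / (h <= d)%N => [H|].
  case/orP: (leq_total h d) => [/H //|dh].
  by rewrite minnC (addnC h) [qnum t h.+1 * _]mulrC H.
rewrite (minn_idPl hd) sumrB -/(qnum t h.+1).
have -> : \sum_(l < h.+1) t ^+ ((h + d).+1 - l) = t ^+ d.+1 * qnum t h.+1.
  rewrite (reindex_inj rev_ord_inj) /qnum mulr_sumr; apply: eq_bigr => l _ /=.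
  by rewrite -exprD; congr (_ ^+ _); have := ltn_ord l; lia.
by rewrite mulrCA qnum_geom; ring.
Qed.

Lemma sum_rev_interval m v K (f : nat -> F) : (v <= m)%N -> (K <= v)%N ->
  \sum_(w < m.+1 | (w <= v)%N && (v - w <= K)%N) f (v - w)%N = \sum_(l < K.+1) f l.
Proof.
move=> vm Kv.
rewrite (reindex_onto (fun l : 'I_K.+1 => inord (v - l) : 'I_m.+1)
                      (fun w => inord (v - w))) /=; last first.
  by move=> w /andP[h1 h2]; apply/val_inj; rewrite /= !inordK ?subKn // ltnS; lia.
apply: congr_big => // l; last first.
  by move=> _; rewrite inordK ?subKn //; have := ltn_ord l; lia.
have lK := ltn_ord l; rewrite inordK ?subKn ?leq_subr //=; [|lia|lia].
by rewrite inord_val eqxx -ltnS lK.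
Qed.

Lemma boxsumZ (R : comNzRingType) n m (c : R) f :
  boxsum n m (fun s => c * f s) = c * boxsum n m f.
Proof. by rewrite -!boxsumE mulr_sumr. Qed.

Lemma eq_boxsum (R : comNzRingType) n m (f f' : seq nat -> R) :
  (forall s, f s = f' s) -> boxsum n m f = boxsum n m f'.
Proof. by move=> H; rewrite -!boxsumE; apply: eq_bigr => nu _; rewrite H. Qed.

(** Iterating the Clebsch-Gordan rule along the gaps of M, s, 0: the
    admissible strips are the highest weight vectors, and a strip of length p
    carries t^p times the q-integer of M - 2p + 1. *)
Lemma strip_weight_sum t m M s : path geq m s -> path geq M s ->
  (t - 1) * strip_weight t M s =
  boxsum (size s) m (fun s' =>
    if strip M s s' then t ^+ (M.+1 - striplen s s') - t ^+ striplen s s' else 0).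
Proof.
elim: s M => [|v s IHs] M /=; first by rewrite subn0 qnum_geom.
case/andP=> vm vs /andP[vM _]; rewrite /= in vm vM.
have ms : path geq m s by apply: (path_geq_head vs); case: (s) vs => //= u s' /andP[uv _];
  exact: leq_trans vm.
pose hd := head 0%N s.
have hdv : (hd <= v)%N by rewrite /hd; case: (s) vs => //= u s' /andP[].
have step (w : 'I_m.+1) :
  boxsum (size s) m (fun s' =>
     if [&& (w <= v)%N, (hd <= w)%N, (v + (v - w) <= M)%N & strip (M - 2 * (v - w)) s s']
     then t ^+ (M.+1 - (v - w + striplen s s')) - t ^+ (v - w + striplen s s') else 0) =
  if (w <= v)%N && (v - w <= minn (M - v) (v - hd))%N
  then (t ^+ ((M - v + (v - hd)).+1 - (v - w)) - t ^+ (v - w)) * strip_weight_tail t s else 0.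
  have -> : (w <= v)%N && (v - w <= minn (M - v) (v - hd))%N =
    [&& (w <= v)%N, (hd <= w)%N & (v + (v - w) <= M)%N] by lia.
  case: ifP => [/and3P[h1 h2 h3]|h]; last first.
    rewrite -[RHS](boxsum0 _ (size s) m); apply: eq_boxsum => s'.
    by rewrite !andbA -[X in X && strip _ _ _]andbA h.
  have sM : path geq (M - 2 * (v - w))%N s.
    by apply: (path_geq_head vs); rewrite -/hd; lia.
  transitivity (t ^+ (v - w) * ((t - 1) * strip_weight t (M - 2 * (v - w))%N s)); last first.
    rewrite strip_weightE -/hd; set q := qnum _ _.
    transitivity (t ^+ (v - w) * ((t - 1) * q) * strip_weight_tail t s); first by ring.
    rewrite qnum_geom mulrBr mulr1 -exprD.
    by congr ((t ^+ _ - _) * _); lia.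
  rewrite (IHs _ ms sM) -boxsumZ; apply: eq_boxsum => s'.
  rewrite h1 h2 h3 /=; case: ifP => hs; last by rewrite mulr0.
  have := strip_len sM hs; rewrite mulrBr -!exprD => hl.
  by congr (t ^+ _ - _); lia.
under [RHS]eq_bigr => w _ do rewrite step.
rewrite -big_mkcond -mulr_suml.
rewrite (sum_rev_interval (fun l => t ^+ ((M - v + (v - hd)).+1 - l) - t ^+ l)) //; last lia.
by rewrite -clebsch_gordan (strip_weightE t v s) -!mulrA.
Qed.

End HorizontalStrips.

(** Interlacing of the two shapes, which is what being a horizontal strip
    means for the parts ([interl_box]). *)
Fixpoint interl (s s' : seq nat) : bool :=
  match s, s' with
  | v :: t, w :: t' => [&& (w <= v)%N, (head 0%N t <= w)%N & interl t t']
  | [::], [::] => true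
  | _, _ => false
  end.

(** The columns of the cells of the strip; the bottom rows come first because
    their cells are to the left. *)
Fixpoint colseq (s s' : seq nat) : seq nat :=
  match s, s' with
  | v :: t, w :: t' => colseq t t' ++ iota w.+1 (v - w)
  | _, _ => [::]
  end.

Lemma size_colseq s s' : size (colseq s s') = striplen s s'.
Proof.
by elim: s s' => [|v s IHs] [|w s'] //=; rewrite size_cat size_iota IHs addnC.
Qed.

Lemma interlP s s' : size s = size s' ->
  reflect (forall i, (i < size s)%N ->
     (nth 0%N s' i <= nth 0%N s i)%N /\ (nth 0%N s i.+1 <= nth 0%N s' i)%N)
    (interl s s').
Proof.
elim: s s' => [|v s IHs] [|w s'] //= => [_|[ss]]; first by left.
apply: (iffP and3P) => [[h1 h2 /(IHs _ ss) h3] [|i] /= hi|H].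
- by rewrite nth0.
- exact: h3.
have [h1 h2] := H 0%N isT; split => //.
by apply/(IHs _ ss) => i hi; exact: (H i.+1).
Qed.

Lemma mem_colseq s s' c : size s = size s' ->
  reflect (exists2 i, (i < size s)%N & (nth 0%N s' i < c <= nth 0%N s i)%N)
    (c \in colseq s s').
Proof.
elim: s s' => [|v s IHs] [|w s'] //= => [_|[ss]]; first by right; case.
rewrite mem_cat mem_iota; apply: (iffP orP) => [[/(IHs _ ss)[i h1 h2]|h]|[[|i] h1 h2]].
- by exists i.+1.
- by exists 0%N => //=; lia.
- by right; move: h2 => /=; lia.
- by left; apply/(IHs _ ss); exists i.
Qed.

Lemma colseq_sorted v s s' : path geq v s -> interl s s' ->
  all (leq^~ (head 0%N s)) (colseq s s') && sorted ltn (colseq s s').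
Proof.
elim: s v s' => [|u s IHs] v [|w s'] //= /andP[_ us] /and3P[wu sw h].
have /andP[h1 h2] := IHs u s' us h; rewrite all_cat; apply/andP; split.
  apply/andP; split.
    by apply/allP => c /(allP h1) /= hc; apply: leq_trans hc (leq_trans sw wu).
  by apply/allP => c; rewrite mem_iota /=; lia.
rewrite (sorted_pairwise ltn_trans) pairwise_cat -!(sorted_pairwise ltn_trans) h2.
rewrite iota_ltn_sorted !andbT; apply/allrelP => c d /(allP h1) /= hc.
by rewrite mem_iota => /andP[hd _]; apply: leq_ltn_trans hc _; apply: leq_ltn_trans sw _.
Qed.

(** The condition on the columns, counted from the right end so that it does
    not change form when the first row is removed. *)
Definition colbound M (c : seq nat) : Prop :=
  forall i, (i < size c)%N -> (nth 0%N c i + 2 * (size c - i) <= M.+1)%N.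

(** In the first row the leftmost cell has the most cells to its right within
    the row and gives the strongest bound; the bounds for the other rows are
    those for M lowered by two for each cell of the first row. *)
Lemma stripP M s s' : path geq M s ->
  strip M s s' <-> interl s s' /\ colbound M (colseq s s').
Proof.
elim: s M s' => [|v s IHs] M [|w s'] //=; try by split=> // -[].
case/andP=> vM vs; rewrite /= in vM.
have cb : (w <= v)%N -> (v + (v - w) <= M)%N ->
    colbound M (colseq s s' ++ iota w.+1 (v - w)) <->
    colbound (M - 2 * (v - w)) (colseq s s').
  move=> wv h; rewrite /colbound size_cat size_iota; split=> H i hi.
    have := H i; rewrite nth_cat hi => /(_ (ltn_addr _ hi)); lia.
  rewrite nth_cat; case: ltnP => hi'; first by have := H i hi'; lia.
  by rewrite nth_iota; lia.
split.
  case/and4P => h1 h2 h3 h4.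
  have sM : path geq (M - 2 * (v - w))%N s by apply: (path_geq_head vs); lia.
  by have [h5 h6] := (IHs _ s' sM).1 h4; rewrite h1 h2 h5; split=> //; apply/cb.
case=> /and3P[h1 h2 h3] h4.
have h5 : (v + (v - w) <= M)%N.
  case: (posnP (v - w)%N) => [->|lp]; first by rewrite addn0.
  have := h4 (size (colseq s s')); rewrite size_cat size_iota nth_cat ltnn subnn.
  rewrite nth_iota // => h; have lt : (size (colseq s s') < size (colseq s s') + (v - w))%N.
    by rewrite -[X in (X < _)%N]addn0 ltn_add2l.
  by have := h lt; lia.
have sM : path geq (M - 2 * (v - w))%N s by apply: (path_geq_head vs); lia.
by rewrite h1 h2 h5 /=; apply/(IHs _ s' sM); split=> //; apply/cb.
Qed.

Section RimStrips.
Variables (n m : nat).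
Implicit Types nu mu : box n m.

Lemma box_part_succ nu (i k : 'I_n) : box_part nu -> (i < k)%N ->
  (nu k <= nth 0%N (boxseq nu) i.+1)%N.
Proof.
move=> /forallP hp ik; have hi := leq_ltn_trans ik (ltn_ord k).
rewrite -[i.+1]/(val (Ordinal hi)) nth_boxseq.
by have /forallP/(_ k)/implyP := hp (Ordinal hi); apply.
Qed.

Lemma interl_boxP nu mu :
  reflect (forall i : 'I_n, (mu i <= nu i)%N /\ (nth 0%N (boxseq nu) i.+1 <= mu i)%N)
    (interl (boxseq nu) (boxseq mu)).
Proof.
have ss : size (boxseq nu) = size (boxseq mu) by rewrite !size_boxseq.
apply: (iffP (interlP ss)) => [H i|H i]; first by
  have := H i; rewrite size_boxseq !nth_boxseq; apply.
by rewrite size_boxseq => hi; have := H (Ordinal hi); rewrite -!nth_boxseq.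
Qed.

Lemma interl_disjoint nu mu (i k : 'I_n) (j : 'I_m) : box_part nu ->
  interl (boxseq nu) (boxseq mu) ->
  (i, j) \in skew nu mu -> (k, j) \in skew nu mu -> i = k.
Proof.
move=> hp /interl_boxP H; rewrite !skewE => /andP[h1 h2] /andP[h3 h4].
case: (ltngtP i k) => [ik|ik|/val_inj //].
  have := leq_trans h4 (leq_trans (box_part_succ hp ik) (leq_trans (H i).2 h1)).
  by rewrite ltnn.
have := leq_trans h2 (leq_trans (box_part_succ hp ik) (leq_trans (H k).2 h3)).
by rewrite ltnn.
Qed.

(** If mu_i < nu_(i+1), the column after the end of row i of mu contains two
    cells of the skew diagram. *)
Lemma interl_box nu mu : box_part nu ->
  interl (boxseq nu) (boxseq mu) =
  [&& box_part mu, box_sub mu nu & hstrip (skew nu mu)].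
Proof.
move=> hp; apply/idP/and3P => [hi|[hm /forallP hs /forallP hh]].
  have H := elimT (interl_boxP nu mu) hi; split.
  - apply/forallP => i; apply/forallP => k; apply/implyP; rewrite leq_eqVlt.
    case/orP => [/eqP/val_inj -> //|ik].
    by apply: leq_trans (H i).2; apply: leq_trans (H k).1 (box_part_succ hp ik).
  - by apply/forallP => i; case: (H i).
  apply/forallP => j; rewrite col_lenE; apply/card_le1_eqP => i k.
  by rewrite inE => h1; rewrite inE => h2; apply: (interl_disjoint hp hi h2 h1).
apply/interl_boxP => i; split; first exact: hs.
case: (ltnP i.+1 n) => hi; last by rewrite nth_default ?size_boxseq.
rewrite -[i.+1]/(val (Ordinal hi)) nth_boxseq leqNgt; apply/negP => lt.
set k := Ordinal hi in lt.
have hj : (mu i < m)%N by apply: leq_trans lt _; rewrite -ltnS.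
have := hh (Ordinal hj); rewrite col_lenE leqNgt => /negP; apply.
have : [set i; k] \subset [set i' | (i', Ordinal hj) \in skew nu mu].
  have ik : (nu k <= nu i)%N.
    by have /forallP/(_ k)/implyP := forallP hp i; apply; rewrite /= leqnSn.
  have mk : (mu k <= mu i)%N.
    by have /forallP/(_ k)/implyP := forallP hm i; apply; rewrite /= leqnSn.
  apply/subsetP => i'; rewrite in_set2 => /orP[] /eqP ->; rewrite inE skewE /=.
    by rewrite leqnn (leq_trans lt).
  by rewrite mk lt.
move/subset_leq_card; rewrite cards2 (_ : i != k) //.
by rewrite -val_eqE /= neq_ltn ltnSn.
Qed.

Lemma cell_colsE nu mu : box_part nu -> interl (boxseq nu) (boxseq mu) ->
  cell_cols (skew nu mu) = colseq (boxseq nu) (boxseq mu).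
Proof.
move=> hp hi; have ss : size (boxseq nu) = size (boxseq mu) by rewrite !size_boxseq.
apply: (irr_sorted_eq ltn_trans ltnn).
- rewrite ltn_sorted_uniq_leq sort_sorted ?andbT; last exact: leq_total.
  rewrite sort_uniq map_inj_in_uniq ?enum_uniq // => -[i j] [k l].
  rewrite !mem_enum => h1 h2 [/val_inj jl]; rewrite -jl in h2 *.
  by rewrite (interl_disjoint hp hi h1 h2).
- have hpath : path geq m (boxseq nu) by rewrite -box_partE.
  by have /andP[] := colseq_sorted hpath hi.
move=> c; rewrite mem_sort; apply/mapP/(mem_colseq _ ss) => [[[i j]]|[i]].
  rewrite mem_enum skewE => /andP[h1 h2] -> /=; exists (nat_of_ord i).
    by rewrite size_boxseq.
  by rewrite !nth_boxseq ltnS h1.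
rewrite size_boxseq => hn /andP[h1 h2].
have c0 : (0 < c)%N by apply: leq_ltn_trans h1.
move: h1 h2; rewrite -[i]/(val (Ordinal hn)) !nth_boxseq => h1 h2.
have cm : (c.-1 < m)%N by rewrite prednK // (leq_trans h2) // -ltnS.
exists (Ordinal hn, Ordinal cm); rewrite /= ?prednK // mem_enum skewE /= prednK //.
by rewrite h2 -ltnS prednK // h1.
Qed.

Lemma rim_hstripsE p nu : box_part nu -> (2 * p <= m)%N ->
  rim_hstrips p nu =
  #|[set mu : box n m | strip m (boxseq nu) (boxseq mu)
              && (striplen (boxseq nu) (boxseq mu) == p)]|.
Proof.
move=> hp pm; apply: eq_card => mu; rewrite !inE.
have hpath : path geq m (boxseq nu) by rewrite -box_partE.
transitivity [&& interl (boxseq nu) (boxseq mu), #|skew nu mu| == p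
   & [forall i : 'I_p,
       (nth 0%N (cell_cols (skew nu mu)) i < m - 2 * p + 2 * i.+1)%N]].
  by rewrite interl_box // -!andbA.
have [hi|hi] := boolP (interl _ _); last first.
  by rewrite /=; apply/esym/negP => /andP[/(stripP _ hpath)[]]; rewrite (negbTE hi).
rewrite cell_colsE //= (_ : #|skew nu mu| = striplen (boxseq nu) (boxseq mu)); last first.
  by rewrite -size_colseq -cell_colsE // size_sort size_map -cardE.
rewrite andbC; case: eqP => [hl|]; rewrite ?andbT ?andbF //.
apply/forallP/idP => [H|/(stripP _ hpath)[_ H] i].
  apply/(stripP _ hpath); split=> // i; rewrite size_colseq hl => ip.
  by have := H (Ordinal ip); rewrite /=; lia.
have := H i; rewrite size_colseq hl => /(_ (ltn_ord i)); have := ltn_ord i; lia.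
Qed.

End RimStrips.

Section RimSum.
Variable F : fieldType.

Lemma sum_hstrips n m t (f : seq nat -> F) :
  (t - 1) * chainsum n m (fun s => strip_weight t m s * f s) =
  \sum_(p < m.+2) (t ^+ (m.+1 - p) - t ^+ p) *
    (\sum_(nu : box n m | box_part nu)
      #|[set mu : box n m | strip m (boxseq nu) (boxseq mu)
              && (striplen (boxseq nu) (boxseq mu) == p)]|%:R * f (boxseq nu)).
Proof.
rewrite -sum_box_part mulr_sumr.
under [RHS]eq_bigr do rewrite mulr_sumr.
rewrite exchange_big; apply: eq_bigr => nu hp /=.
have hpath : path geq m (boxseq nu) by rewrite -box_partE.
rewrite mulrA (strip_weight_sum _ hpath hpath) size_boxseq -boxsumE.
under [RHS]eq_bigr do rewrite mulrA.
rewrite -mulr_suml; congr (_ * _).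
rewrite -big_mkcond /=.
rewrite (partition_big (fun mu : box n m =>
  inord (striplen (boxseq nu) (boxseq mu)) : 'I_m.+2) predT) //=.
apply: eq_bigr => p _; rewrite mulrC sum_card_set.
have lt (mu : box n m) : strip m (boxseq nu) (boxseq mu) ->
    (striplen (boxseq nu) (boxseq mu) < m.+2)%N.
  by move/(strip_len hpath); lia.
rewrite (eq_bigl (fun mu : box n m => strip m (boxseq nu) (boxseq mu)
              && (striplen (boxseq nu) (boxseq mu) == p))) => [|mu].
  by apply: eq_bigr => mu /andP[_ /eqP ->].
by case h: (strip _ _ _) => //=; rewrite -val_eqE /= inordK // lt.
Qed.

(** An admissible strip has at most m/2 cells, by [strip_len]. *)
Lemma strip_sum_large n m q (f : seq nat -> F) : (m < 2 * q)%N ->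
  \sum_(nu : box n m | box_part nu)
      #|[set mu : box n m | strip m (boxseq nu) (boxseq mu)
              && (striplen (boxseq nu) (boxseq mu) == q)]|%:R * f (boxseq nu) = 0.
Proof.
move=> mq; rewrite big1 // => nu hp.
have hpath : path geq m (boxseq nu) by rewrite -box_partE.
rewrite (_ : #|_| = 0)%N ?mul0r //; apply: eq_card0 => mu; rewrite !inE.
by apply/negP => /andP[/(strip_len hpath) h /eqP e]; move: h; rewrite e leqNgt mq.
Qed.

End RimSum.

(** * The characters in the field of rational functions *)

(** The box without columns contains only the empty shape. *)
Lemma rim_vstrips0 n (nu : box n 0) : box_part nu -> rim_vstrips 0 nu = 1%N.
Proof.
move=> hp; rewrite /rim_vstrips -(cards1 nu); apply: eq_card => mu; rewrite !inE.
have -> : mu = nu by apply/ffunP => i; case: (mu i) (nu i) => [[]] // ? [[]] // ?; apply/val_inj.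
rewrite eqxx hp card_skew big1 ?eqxx => [|i _]; last exact: subnn.
apply/and4P; split=> //.
- by apply/forallP => i.
- by apply/forallP => i; rewrite row_len_skew subnn.
by apply/forallP => -[i []].
Qed.

Section ColumnCharacters.
Variables (K : fieldType) (n : nat).
Hypothesis charK : [pchar K] =i pred0.
Let F := ratfun K n.

Definition sqrt_var (j : 'I_n) : F := tofrac ('X_j : {mpoly K[n]}).
Definition var (j : 'I_n) : F := sqrt_var j ^+ 2.

Lemma pchar_ratfun : [pchar F] =i pred0.
Proof.
move=> p; rewrite -charK.
exact: (fmorph_pchar ((@tofrac {mpoly K[n]}) \o (@mpolyC n K))).
Qed.

(** Points of evaluation separate the required polynomials. *)
Lemma var_generic : generic var.
Proof.
have ev (v : 'I_n -> K) (P Q : {mpoly K[n]}) : tofrac P = tofrac Q -> P.@[v] = Q.@[v].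
  by move=> /eqP; rewrite tofrac_eq => /eqP ->.
rewrite /var /sqrt_var; split=> [i|i j ij|i j].
- rewrite -tofracXn -tofrac0 tofrac_eq; apply/eqP => /(congr1 (meval (fun=> 1))).
  by rewrite rmorphXn /= mevalXU meval0 expr1n => /eqP; rewrite oner_eq0.
- rewrite -!tofracXn; apply/eqP => /(ev (fun k => (k == i)%:R)).
  rewrite !rmorphXn /= !mevalXU eqxx eq_sym (negbTE ij) expr1n expr0n /= => /eqP.
  by rewrite oner_eq0.
rewrite -!tofracXn -tofracM -tofrac1; apply/eqP => /(ev (fun=> 0)).
rewrite rmorphM !rmorphXn /= !mevalXU meval1 expr0n mul0r => /eqP.
by rewrite eq_sym oner_eq0.
Qed.

Lemma xpowE j q (z : int) : 2 * q = z%:~R -> xpow K j q = sqrt_var j ^ z.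
Proof. by move=> e; rewrite /xpow e intrKfloor. Qed.

Lemma xpow_nat j q k : 2 * q = k%:R -> xpow K j q = sqrt_var j ^+ k.
Proof. by move=> e; rewrite (@xpowE _ _ k%:Z) ?exprnP. Qed.

Lemma det_xpow_subE e (z : 'I_n -> int) : (forall i, 2 * e i = (z i)%:~R) ->
  det_xpow_sub K e = sdiffz sqrt_var z.
Proof.
move=> H; congr (\det _); apply/matrixP => i j; rewrite !mxE.
by rewrite (xpowE _ (H i)) (@xpowE _ _ (- z i)) // mulrN H rmorphN.
Qed.

Lemma det_xpow_addE e (z : 'I_n -> int) : (forall i, 2 * e i = (z i)%:~R) ->
  det_xpow_add K e = saddz sqrt_var z.
Proof.
move=> H; congr (\det _); apply/matrixP => i j; rewrite !mxE.
by rewrite (xpowE _ (H i)) (@xpowE _ _ (- z i)) // mulrN H rmorphN.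
Qed.

Lemma sdiffE (e : 'I_n -> nat) : sdiffz sqrt_var (fun i => (e i)%:Z) = sdiff sqrt_var e.
Proof.
congr (\det _); apply/matrixP => i j; rewrite !mxE.
by rewrite -exprnN -exprnP.
Qed.

Lemma schur_boxseq m (nu : box n m) :
  schur K (weight_of nu) = schurx var (boxseq nu).
Proof.
rewrite /schur /schurx -det_vandermonde /det_xpow; congr (_ / _); congr (\det _);
  apply/matrixP => i j; rewrite !mxE /var -exprM; apply: xpow_nat.
  by rewrite /weight_of /delta -natrD -natrM nth_boxseq.
by rewrite /delta -natrM.
Qed.

Lemma xprod_powE c m : 2 * c = m%:R -> xprod_pow K n (- c) = \prod_j sqrt_var j ^- m.
Proof.
move=> e; apply: eq_bigr => j _; rewrite exprnN; apply: xpowE.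
by rewrite mulrN e rmorphN.
Qed.

Lemma two_neq0 : (2 : F) != 0.
Proof. exact: (natr_neq0 pchar_ratfun 1). Qed.

Lemma so_odd_denominator : det_xpow_sub K (fun i : 'I_n => delta i + 2^-1) =
  vandermonde (theta \o var) * \prod_j (sqrt_var j - (sqrt_var j)^-1).
Proof.
rewrite (weyl_denominator_B var_generic) -sdiffE; apply: det_xpow_subE => i.
by rewrite /delta -pmulrn natrD natrM mulrDr mulfV // addrC.
Qed.

Lemma sp_even_denominator : det_xpow_sub K (fun i : 'I_n => delta i + 1) =
  vandermonde (theta \o var) * \prod_j (var j - (var j)^-1).
Proof.
rewrite (weyl_denominator_C pchar_ratfun var_generic) -sdiffE; apply: det_xpow_subE => i.
rewrite /delta; have -> : (n - i = (n - i.+1).+1)%N by have := ltn_ord i; lia.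
by rewrite -pmulrn natrM -[X in _ * X%:R]addn1 natrD.
Qed.

Lemma sp_even_column c p : (p <= n)%N ->
  sp_even K (@two_block n p c%:R (c%:R - 1)) =
    xprod_pow K n (- c%:R) *
    \sum_(nu : box n (2 * c)%N | box_part nu && (oddrows (diagram nu) == p))
      schur K (weight_of nu).
Proof.
move=> pn; rewrite /sp_even sp_even_denominator; have d0 := weyl_denominator_C_neq0 var_generic.
have -> : det_xpow_sub K (fun i => two_block p c%:R (c%:R - 1) i + delta i + 1) =
    sdiff sqrt_var (colexp (2 * c) p).
  rewrite -sdiffE; apply: det_xpow_subE => i; rewrite /two_block /delta /colexp.
  have -> : (n - i = (n - i.+1).+1)%N by have := ltn_ord i; lia.
  by case: ifP => _; rewrite -pmulrn natrD !natrM -?natr1; ring.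
rewrite -(C_column_identity pchar_ratfun var_generic c pn) (@xprod_powE _ (2 * c)); last first.
  by rewrite natrM.
rewrite big_split /= mulrA -[X in X / _]mulrA mulrC mulKf //; congr (_ * _).
by apply: eq_big => nu; [rewrite oddrows_diagram | rewrite schur_boxseq].
Qed.

Lemma so_odd_column (c : rat) m p : 2 * c = m%:R -> (p <= n)%N ->
  (m == 0 -> p = 0)%N ->
  so_odd K (@two_block n p c (c - 1)) =
    xprod_pow K n (- c) *
    \sum_(nu : box n m | box_part nu)
      (rim_vstrips p nu)%:R * schur K (weight_of nu).
Proof.
move=> cm pn mp; rewrite /so_odd so_odd_denominator; have d0 := weyl_denominator_B_neq0 var_generic.
rewrite (xprod_powE cm).
have -> : \sum_(nu : box n m | box_part nu) (rim_vstrips p nu)%:R * schur K (weight_of nu) =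
    \sum_(nu : box n m | box_part nu) (rim_vstrips p nu)%:R * schurx var (boxseq nu).
  by apply: eq_bigr => nu _; rewrite schur_boxseq.
case: m cm mp => [|m] cm mp.
  have c0 : c = 0 by apply: (mulfI (_ : 2 != 0)); rewrite // cm mulr0.
  rewrite mp // (_ : det_xpow_sub _ _ = det_xpow_sub K (fun i : 'I_n => delta i + 2^-1)).
    rewrite so_odd_denominator divff // big1 => [|j _]; last by rewrite expr0 invr1.
    rewrite mul1r (eq_bigr (fun nu => schurx var (boxseq nu))) => [|nu hp]; last first.
      by rewrite rim_vstrips0 ?mul1r.
    by rewrite (sum_box_part _ 0 (schurx _)) (chainsum_schur0 var_generic).
  congr (\det _); apply/matrixP => i j; rewrite !mxE /two_block subn0 ltn_ord c0 add0r //.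
have -> : det_xpow_sub K (fun i => two_block p c (c - 1) i + delta i + 2^-1) =
    sdiff sqrt_var (colexp m p).
  rewrite -sdiffE; apply: det_xpow_subE => i; rewrite /two_block /delta /colexp.
  have -> : (n - i = (n - i.+1).+1)%N by have := ltn_ord i; lia.
  rewrite !mulrDr mulfV // -pmulrn natrD !natrM.
  by case: ifP => _; rewrite ?mulrDr cm -!natr1; ring.
rewrite -(B_column_identity pchar_ratfun var_generic m pn) -(@sum_vstrips F n m p (schurx var)).
by rewrite big_split /= mulrA -[X in X / _]mulrA mulrC mulKf.
Qed.

End ColumnCharacters.

Section RowCharacters.
Variables (K : fieldType) (n : nat).
Hypothesis charK : [pchar K] =i pred0.
Let F := ratfun K n.+1.
Let cF := pchar_ratfun n.+1 charK.
Let gx := @var_generic K n.+1.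
Notation sqrt_var := (@sqrt_var K n.+1).
Notation var := (@var K n.+1).

Lemma so_even_denominator : det_xpow_add K (@delta n.+1) = 2 * vandermonde (theta \o var).
Proof.
have := D_row_identity cF gx (two_neq0 _ charK) (leqnn 0).
rewrite (eq_bigl (@box_part n.+1 0)) => [|nu]; last first.
  have [hp|//] := boolP (box_part nu); rewrite -leqn0.
  by apply: alt_weight_le; rewrite -box_partE.
rewrite (sum_box_part _ 0 (schurx _)) (chainsum_schur0 gx) mulr1.
rewrite big1 ?mulr1 => [|j _]; last by rewrite expr0 invr1.
have -> : sdiffz sqrt_var (rowexp 0 0) = 0.
  rewrite /sdiffz (expand_det_row _ ord_max) big1 // => j _.
  by rewrite mxE /rowexp /= ltnn subrr mul0r.
rewrite addr0 => ->; rewrite mulrC divfK ?two_neq0 //; apply: det_xpow_addE => i.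
rewrite /rowexp /delta; case: ltnP => hi; first by rewrite -pmulrn natrM.
by have /eqP -> : (n.+1 - i.+1 == 0)%N; [rewrite subn_eq0 | rewrite mulr0 subrr].
Qed.

(** The shift e/2 is 0 in type D and 1/2 in type B. *)
Lemma row_exponent (c : rat) m p (i : 'I_n.+1) (e : nat) : 2 * c = m%:R ->
  2 * (@two_block n.+1 1 c (c - p%:R) i + delta i + e%:R / 2) =
  (rowexp (m + e) p i)%:~R.
Proof.
move=> cm; rewrite /two_block /delta /rowexp subn1 /= !mulrDr mulrCA mulfV // mulr1.
case: ltnP => hi.
  by rewrite -pmulrn (natrD _ (m + e)) natrM (natrD _ m) cm; ring.
have -> : (n.+1 - i.+1 = 0)%N by apply/eqP; rewrite subn_eq0.
rewrite rmorphB /= -!pmulrn natrM (natrD _ m) mulrDr cm; ring.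
Qed.

Lemma so_even_row (c : rat) m p : 2 * c = m%:R -> (p <= m)%N ->
  so_even K (@two_block n.+1 1 c (c - p%:R)) =
    xprod_pow K n.+1 (- c) *
    \sum_(nu : box n.+1 m | box_part nu &&
                           (oddcols (skew (box_full n.+1 m) nu) == p))
      schur K (weight_of nu).
Proof.
move=> cm pm; rewrite /so_even so_even_denominator (@xprod_powE K n.+1 c m cm).
have h2 := two_neq0 n.+1 charK.
have H i : 2 * (@two_block n.+1 1 c (c - p%:R) i + delta i) = (rowexp m p i)%:~R.
  by have := row_exponent p i 0 cm; rewrite addn0 mul0r addr0.
rewrite (@det_xpow_addE K n.+1 _ _ H) (@det_xpow_subE K n.+1 _ _ H) invfM mulrA -D_row_identity //.
have v0 := vandermonde_neq0 (theta_neq gx).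
rewrite -[X in X / _]mulrA [X in X / _]mulrC mulfK //; congr (_ * _).
apply: eq_big => nu; last by rewrite schur_boxseq.
have [hp|//] := boolP (box_part nu); have [-> ocm] := oddcols_alt_weight hp.
by apply/eqP/eqP; lia.
Qed.

Lemma so_odd_row (c : rat) m p : 2 * c = m%:R -> p%:R <= c ->
  so_odd K (@two_block n.+1 1 c (c - p%:R)) =
    xprod_pow K n.+1 (- c) *
    \sum_(nu : box n.+1 m | box_part nu)
      (rim_hstrips p nu)%:R * schur K (weight_of nu).
Proof.
move=> cm pc; rewrite /so_odd so_odd_denominator (@xprod_powE K n.+1 c m cm).
have d0 := weyl_denominator_B_neq0 gx.
have pm : (2 * p <= m)%N.
  by rewrite -(ler_nat rat) natrM -cm ler_pM2l.
have H i : 2 * (@two_block n.+1 1 c (c - p%:R) i + delta i + 2^-1) =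
    (rowexp m.+1 p i)%:~R.
  by have := row_exponent p i 1 cm; rewrite addn1 mul1r.
rewrite (@det_xpow_subE K n.+1 _ _ H).
rewrite -(B_row_identity cF gx (fun q => @strip_sum_large F n.+1 m q (schurx var))
            (fun t => @sum_hstrips F n.+1 m t (schurx var)) pm).
rewrite big_split /= mulrA -[X in X / _]mulrA mulrC mulKf //; congr (_ * _).
by apply: eq_bigr => nu hp; rewrite schur_boxseq rim_hstripsE.
Qed.

End RowCharacters.

Theorem theorem2 (K : fieldType) (charK : [pchar K] =i pred0)
    (n p : nat) (n_gt0 : (0 < n)%N) :
  [/\ (* c a nonnegative integer *)
      forall c : nat, (p <= n)%N ->
        is_partition (@two_block n p c%:R (c%:R - 1)) ->
        sp_even K (@two_block n p c%:R (c%:R - 1)) =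
          xprod_pow K n (- c%:R) *
          \sum_(nu : box n (2 * c)%N | box_part nu && (oddrows (diagram nu) == p))
            schur K (weight_of nu),
      (* c a nonnegative integer or half-integer, m = 2c *)
      forall (c : rat) (m : nat), 2 * c = m%:R -> (p <= m)%N ->
        is_orthogonal_partition (@two_block n 1 c (c - p%:R)) \/
        is_orthogonal_half_partition (@two_block n 1 c (c - p%:R)) ->
        so_even K (@two_block n 1 c (c - p%:R)) =
          xprod_pow K n (- c) *
          \sum_(nu : box n m | box_part nu &&
                               (oddcols (skew (box_full n m) nu) == p))
            schur K (weight_of nu),
      (* c a nonnegative integer or half-integer, m = 2c *)
      forall (c : rat) (m : nat), 2 * c = m%:R -> (p <= n)%N ->
        is_partition (@two_block n p c (c - 1)) \/
        is_half_partition (@two_block n p c (c - 1)) ->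
        so_odd K (@two_block n p c (c - 1)) =
          xprod_pow K n (- c) *
          \sum_(nu : box n m | box_part nu)
            (rim_vstrips p nu)%:R * schur K (weight_of nu)
    & (* c a nonnegative integer or half-integer, m = 2c *)
      forall (c : rat) (m : nat), 2 * c = m%:R -> p%:R <= c ->
        is_partition (@two_block n 1 c (c - p%:R)) \/
        is_half_partition (@two_block n 1 c (c - p%:R)) ->
        so_odd K (@two_block n 1 c (c - p%:R)) =
          xprod_pow K n (- c) *
          \sum_(nu : box n m | box_part nu)
            (rim_hstrips p nu)%:R * schur K (weight_of nu)].
Proof.
case: n n_gt0 => // n' _; split.
- by move=> c pn _; apply: sp_even_column.
- by move=> c m cm pm _; apply: so_even_row.
- move=> c m cm pn hpart; apply: so_odd_column => // m0.
  have c0 : c = 0 by apply: (mulfI (_ : 2 != 0)); rewrite // cm (eqP m0) mulr0.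
  case: p pn hpart => // p pn hpart; exfalso.
  have : 0 <= @two_block n'.+1 p.+1 c (c - 1) ord_max.
    by case: hpart => -[_ /(_ ord_max)[]].
  rewrite /two_block ltnNge (_ : (n'.+1 - p.+1 <= _)%N) ?c0 //=.
  by rewrite subSS leq_subr.
by move=> c m cm pc _; apply: so_odd_row.
Qed.
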